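(* Let $Q\in\mathcal{M}_{\mathrm{div}}$ be parameterized by the convex function $s$, i.e. $\operatorname{Hess}(s)=R^TQR$. Given a finite set of points $\mathcal{V}$ in $\Omega$ (not all collinear), there exists a triangulation of those points such that all $q^h_{ij}\ge0$ (a ''$Q$-adapted triangulation''). If there exists no edge for which $q^h_{ij}=0$, this triangulation is unique.
   Context: $\Omega$ is a bounded convex subset of $\mathbb{R}^2$ with $C^2$ boundary; $R=\begin{pmatrix}0&-1\\1&0\end{pmatrix}$. $\mathcal{M}$ is the space of uniformly elliptic, bounded, symmetric $2\times2$ matrix fields on $\Omega$. For $M\in\mathcal{M}$, its harmonic coordinates $F_M=(F_1,F_2):\Omega\to\Omega$ are the weak solutions of $\operatorname{div}(M\nabla F_i)=0$ in $\Omega$, $F_i(x)=x_i$ on $\partial\Omega$ (it is known that $F_M$ is a homeomorphism with $\det\nabla F_M>0$ a.e.); convention $(\nabla F)_{ij}=\partial_iF_j$. $\mathcal{M}_{\mathrm{div}}$ is the set of all matrix fields $\frac{(\nabla F_M)^TM\nabla F_M}{\det(\nabla F_M)}\circ F_M^{-1}$, $M\in\mathcal{M}$; these are symmetric, positive, divergence-free matrix fields with $L^1(\Omega)$ entries and determinants uniformly bounded away from $0$ and $\infty$. Each $Q\in\mathcal{M}_{\mathrm{div}}$ has a convex $s\in W^{2,1}(\Omega)$, unique up to affine functions, with $\operatorname{Hess}(s)=R^TQR$. For a triangulation of the points, with $s_i=s(x_i)$ the value of $s$ at vertex $i$, $q^h_{ij}$ is defined for each interior edge $(i,j)$ (edge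 shared by two triangles $t_{ijk}$ and $t_{ijl}$) by the hinge formula $$q^h_{ij}=-\frac{\cot\theta_{ijk}+\cot\theta_{ijl}}{|e_{ij}|^2}s_i-\frac{\cot\theta_{jik}+\cot\theta_{jil}}{|e_{ij}|^2}s_j+\frac{s_k}{2|t_{ijk}|}+\frac{s_l}{2|t_{ijl}|},$$ where $|e_{ij}|$ is the length of edge $(i,j)$, $|t_{ijk}|$ the (unsigned) area of the triangle with vertices $i,j,k$, and $\theta_{ijk}$ the interior angle of that triangle at vertex $j$. *)

(* Defs.v *)
From HB Require Import structures.
From mathcomp Require Import all_boot all_order all_algebra finmap.
From mathcomp Require Import all_classical all_reals all_analysis.

Set Implicit Arguments.
Unset Strict Implicit.
Unset Printing Implicit Defensive.

Import Order.TTheory GRing.Theory Num.Theory.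
Import numFieldNormedType.Exports.

Local Open Scope classical_set_scope.
Local Open Scope ring_scope.

(** The library norm of [R * R] is the max norm: it gives the right topology and
    bounded sets, but Euclidean lengths and angles have to go through [dot]. *)

Definition coord {R : realType} (x : R * R) (i : 'I_2) : R :=
  if i == 0 then x.1 else x.2.

Definition unit_vec {R : realType} (i : 'I_2) : R * R :=
  ((i == 0)%:R, (i == 1)%:R).

Definition dot {R : realType} (x y : R * R) : R := x.1 * y.1 + x.2 * y.2.

Definition enorm {R : realType} (x : R * R) : R := Num.sqrt (dot x x).

(** The library measures Borel sets only.  Measurable functions and fields below
    are thus Borel representatives of their a.e. classes. *)
Definition leb2 (R : realType) :
    {measure set (measurableTypeR R * measurableTypeR R) -> \bar R} :=
  (@lebesgue_measure R \x @lebesgue_measure R)%E.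

Definition C2_fun {R : realType} (g : R -> R) : Prop :=
  [/\ forall t, derivable g t 1, forall t, derivable (derive1 g) t 1
    & continuous (derive1 (derive1 g))].

(** Near each boundary point, and in suitably rotated coordinates with axes
    [(a, b)] and [(- b, a)], the set is the strict epigraph of a C^2 function. *)
Definition C2_boundary {R : realType} (Om : set (R * R)) : Prop :=
  forall p, (closure Om `\` interior Om) p ->
    exists (r a b : R) (g : R -> R),
      [/\ 0 < r, a ^+ 2 + b ^+ 2 = 1, C2_fun g
        & forall x, ball p r x ->
            (Om x <-> g (a * x.1 + b * x.2) < - b * x.1 + a * x.2)].

Definition C2_convex_domain {R : realType} (Om : set (R * R)) : Prop :=
  [/\ open Om, bounded_set Om, convex_set Om & C2_boundary Om].

Definition smooth {R : realType} (phi : R * R -> R) : Prop :=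
  forall w : seq 'I_2,
    let f := foldr (fun i (g : R * R -> R) x => 'D_(unit_vec i) g x) phi w in
    continuous f /\ forall i x, derivable f x (unit_vec i).

Definition test_function {R : realType} (Om : set (R * R)) (phi : R * R -> R)
    : Prop :=
  smooth phi /\
  exists K : set (R * R),
    [/\ compact K, K `<=` Om & forall x, ~ K x -> phi x = 0].

Definition grad {R : realType} (phi : R * R -> R) (x : R * R) : 'cV[R]_2 :=
  \col_i 'D_(unit_vec i) phi x.

Definition Lp_on {R : realType} (p : nat) (Om : set (R * R)) (u : R * R -> R)
    : Prop :=
  measurable_fun Om u /\
  (leb2 R).-integrable Om (fun x => (`|u x| ^+ p)%:E).

(** Only meaningful for [u] and [g] locally integrable on [Om]; every use below
    also asks for [Lp_on]. *)
Definition weak_partial {R : realType} (Om : set (R * R)) (i : 'I_2)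
    (u g : R * R -> R) : Prop :=
  forall phi, test_function Om phi ->
    \int[leb2 R]_(x in Om) (u x * 'D_(unit_vec i) phi x) =
    - \int[leb2 R]_(x in Om) (g x * phi x).

Definition sobolev_1p {R : realType} (p : nat) (Om : set (R * R))
    (u : R * R -> R) (Du : R * R -> 'cV[R]_2) : Prop :=
  Lp_on p Om u /\
  forall i, Lp_on p Om (fun x => Du x i 0) /\
            weak_partial Om i u (fun x => Du x i 0).

(** W^{1,2}_0, the closure of the test functions in W^{1,2}. *)
Definition sobolev_12_0 {R : realType} (Om : set (R * R))
    (u : R * R -> R) (Du : R * R -> 'cV[R]_2) : Prop :=
  sobolev_1p 2 Om u Du /\
  exists phi : nat -> R * R -> R,
    (forall n, test_function Om (phi n)) /\
    (fun n => \int[leb2 R]_(x in Om)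
       ((phi n x - u x) ^+ 2 + \sum_i (grad (phi n) x i 0 - Du x i 0) ^+ 2))
      @ \oo --> (0 : R).

(** [s] is in W^{2,1}, with gradient [Ds] and Hessian [H]. *)
Definition sobolev_21 {R : realType} (Om : set (R * R))
    (s : R * R -> R) (Ds : R * R -> 'cV[R]_2) (H : R * R -> 'M[R]_2) : Prop :=
  sobolev_1p 1 Om s Ds /\
  forall j, sobolev_1p 1 Om (fun x => Ds x j 0) (fun x => col j (H x)).

Definition measurable_field {R : realType} (Om : set (R * R))
    (M : R * R -> 'M[R]_2) : Prop :=
  forall i j, measurable_fun Om (fun x => M x i j : R).

Definition conductivity {R : realType} (Om : set (R * R))
    (M : R * R -> 'M[R]_2) : Prop :=
  measurable_field Om M /\
  exists lam Lam : R, 0 < lam /\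
    {ae leb2 R, forall x, Om x ->
      [/\ (M x)^T = M x, forall i j, `|M x i j| <= Lam
        & forall xi : 'cV[R]_2,
            lam * (xi^T *m xi) 0 0 <= (xi^T *m M x *m xi) 0 0]}.

(** [DF x i j] is the [i]-th weak derivative of the [j]-th component of [F];
    the boundary condition [F = id] is understood in the sense of W^{1,2}_0. *)
Definition harmonic_coordinates {R : realType} (Om : set (R * R))
    (M : R * R -> 'M[R]_2) (F : R * R -> R * R) (DF : R * R -> 'M[R]_2) : Prop :=
  forall j,
    [/\ sobolev_1p 2 Om (fun x => coord (F x) j) (fun x => col j (DF x)),
        forall phi, test_function Om phi ->
          \int[leb2 R]_(x in Om)
            (((grad phi x)^T *m M x *m col j (DF x)) 0 0) = 0
      & sobolev_12_0 Om (fun x => coord (F x) j - coord x j)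
                        (fun x => col j (DF x - 1%:M))].

Definition homeomorphism_on {R : realType} (Om : set (R * R))
    (F G : R * R -> R * R) : Prop :=
  [/\ forall x, Om x -> Om (F x) /\ G (F x) = x,
      forall y, Om y -> Om (G y) /\ F (G y) = y,
      {within Om, continuous F} & {within Om, continuous G}].

(** [homeomorphism_on] selects the continuous representative of the harmonic
    coordinates and names its inverse [G]. *)
Definition in_Mdiv {R : realType} (Om : set (R * R)) (Q : R * R -> 'M[R]_2)
    : Prop :=
  measurable_field Om Q /\
  exists (M : R * R -> 'M[R]_2) (F G : R * R -> R * R) (DF : R * R -> 'M[R]_2),
    [/\ conductivity Om M, harmonic_coordinates Om M F DF,
        homeomorphism_on Om F G
      & {ae leb2 R, forall y, Om y ->
          Q y = (\det (DF (G y)))^-1 *: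
                  ((DF (G y))^T *m M (G y) *m DF (G y))}].

Definition rot90 (R : realType) : 'M[R]_2 := delta_mx 1 0 - delta_mx 0 1.

Definition parameterized_by {R : realType} (Om : set (R * R))
    (Q : R * R -> 'M[R]_2) (s : R * R -> R) : Prop :=
  convex_function Om s /\
  exists Ds, sobolev_21 Om s Ds (fun x => (rot90 R)^T *m Q x *m rot90 R).

Definition collinear {R : realType} (A : {fset (R * R)}) : Prop :=
  exists a b c : R, (a, b) <> (0, 0) /\
    forall v, v \in A -> a * v.1 + b * v.2 = c.

Definition hull {R : realType} (A : {fset (R * R)}) : set (R * R) :=
  [set p | exists w : R * R -> R,
     [/\ forall v, v \in A -> 0 <= w v, \sum_(v <- A) w v = 1
       & p = \sum_(v <- A) w v *: v]].

(** A triangle is given by its set of three vertices.  The vertices of the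
    triangulation are exactly the points of [V], the triangles cover the convex
    hull of [V], and any two of them meet along a common face. *)
Definition triangulation {R : realType} (V : {fset (R * R)})
    (T : {fset {fset (R * R)}}) : Prop :=
  [/\ forall t, t \in T -> [/\ (t `<=` V)%fset, #|` t| = 3%N & ~ collinear t],
      forall v, v \in V -> exists2 t, t \in T & v \in t,
      hull V = [set p | exists2 t, t \in T & hull t p]
    & forall t u, t \in T -> u \in T ->
        hull t `&` hull u = hull (t `&` u)%fset].

(** [k] and [l] are the vertices opposite to the edge [(i, j)]. *)
Definition interior_edge {R : realType} (T : {fset {fset (R * R)}})
    (i j k l : R * R) : Prop :=
  [/\ [fset i; j; k]%fset \in T, [fset i; j; l]%fset \in T & k != l].

(** Interior angle at [y] of the triangle [x y z]. *)
Definition angle {R : realType} (x y z : R * R) : R :=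
  acos (dot (x - y) (z - y) / (enorm (x - y) * enorm (z - y))).

Definition cot {R : realType} (t : R) : R := cos t / sin t.

Definition tri_area {R : realType} (x y z : R * R) : R :=
  `|(y.1 - x.1) * (z.2 - x.2) - (y.2 - x.2) * (z.1 - x.1)| / 2.

Definition hinge {R : realType} (s : R * R -> R) (i j k l : R * R) : R :=
  - ((cot (angle i j k) + cot (angle i j l)) / enorm (i - j) ^+ 2) * s i
  - ((cot (angle j i k) + cot (angle j i l)) / enorm (i - j) ^+ 2) * s j
  + s k / (2 * tri_area i j k) + s l / (2 * tri_area i j l).

Definition adapted {R : realType} (s : R * R -> R) (T : {fset {fset (R * R)}})
    : Prop :=
  forall i j k l, interior_edge T i j k l -> 0 <= hinge s i j k l.

(* Main.v *)
Require Import Defs.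
From HB Require Import structures.
From mathcomp Require Import all_boot all_order all_algebra finmap.
From mathcomp Require Import all_classical all_reals all_analysis.
From mathcomp Require Import ring lra.
Import Order.TTheory GRing.Theory Num.Theory.
Import numFieldNormedType.Exports.
Local Open Scope classical_set_scope.
Local Open Scope ring_scope.

Set Implicit Arguments.
Unset Strict Implicit.
Unset Printing Implicit Defensive.

(** Write [interp s t] for the affine function that agrees with [s] at the vertices
of the triangle [t].  If [ijk] and [ijl] are two triangles of a triangulation,
then [s l - interp s ijk l] is a positive multiple of the hinge value at [ij]
([interior_edge_hinge]).  So the sign of the hinge says whether the piecewise
affine interpolant of [s] is convex across that edge, and an adapted
triangulation is one whose interpolant is convex across every interior edge
([adapted_edge_convex]).

Existence.  Lift each point [v] to height [s v].  If no lifted point lies on the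
plane through three others, and none lies above a triangle of other lifted
points that it projects into, the lower convex hull of the lifted points projects
to a triangulation that uses all of [V]
([lower_faces_triangulation]): two lower faces have the same height over a
common point, so that point is carried by their common vertices, and the hull is
covered because a triangle over a generic point whose lifted height is smallest
there can only be a lower face.  A convex [s] need not satisfy these conditions;
it does so after adding [e |v|^2 + e^(n + 2)], with [n] the rank of [v] in [V],
for a small [e > 0], and an [e] that also keeps the strict inequalities of [s]
makes the resulting triangulation convex across edges for [s] itself
([edge_convex_exists]).

Uniqueness.  Convexity across edges is global: for a triangle [t] of [T] and
[v] in [V], walk from a generic point of [t] straight to [v]; each edge that is
crossed can only raise the height at [v] of the current affine function, and the
height at arrival is [s v].  Hence [interp s t v <= s v]
([edge_convex_below]), and strictly so for [v] outside [t] if no hinge vanishes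
([strict_edge_convex_below]).  So every triangle of an adapted
triangulation is lifted onto the lower convex hull of the lifted points, and in
the strict case no further point of [V] is lifted into its plane.  Every adapted
triangulation must then consist of the same triangles
([edge_convex_unique]). *)

Section Triangulations.
Variable R : realType.

(** * Small parameters and extremal choices *)

(** Off the constant term, [p] is bounded by a multiple of the argument. *)
Lemma poly_sign_near0 (p : {poly R}) : p.[0] != 0 ->
  exists2 d : R, 0 < d & forall e, 0 < e < d -> 0 < p.[e] * p.[0].
Proof.
move=> p0.
have /factor_theorem[r Hr] : root (p - p.[0]%:P) 0.
  by rewrite /root !hornerE subrr.
have He e : p.[e] = p.[0] + r.[e] * e.
  have /eqP : (p - p.[0]%:P).[e] = (r * ('X - 0%:P)).[e] by rewrite Hr.
  by rewrite !hornerE subr0 subr_eq => /eqP ->; rewrite addrC.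
have [B HB] := poly_disk_bound r 1.
have B0 : 0 <= B by apply: le_trans (HB 0 _); rewrite ?normr0 ?ler01 ?normr_ge0.
have a0 : 0 < `|p.[0]| by rewrite normr_gt0.
exists (Num.min 1 (`|p.[0]| / (B + 1))).
  by rewrite lt_min ltr01 divr_gt0 // ltr_wpDl.
move=> e /andP[e0]; rewrite lt_min => /andP[e1 e2].
move: e2; rewrite ltr_pdivlMr ?ltr_wpDl // => e2.
have Hb : `|r.[e]| <= B by apply: HB; rewrite ger0_norm ltW.
have : `|r.[e] * e| < `|p.[0]|.
  rewrite normrM (ger0_norm (ltW e0)).
  apply: le_lt_trans e2; rewrite mulrC ler_wpM2l ?(ltW e0) //.
  by rewrite (le_trans Hb) // lerDl.
rewrite (He e) mulrDl -expr2 -real_normK ?num_real // => h.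
have : `|r.[e] * e * p.[0]| < `|p.[0]| ^+ 2.
  by rewrite normrM expr2 ltr_pM2r.
by rewrite ltr_norml; set z := _ * p.[0]; lra.
Qed.

(** A single small parameter makes finitely many nonzero polynomials nonzero and
preserves the sign of those that are positive at 0.  All the general position
arguments below are instances. *)
Lemma small_param (ps : seq {poly R}) : exists e : R, [/\ 0 < e, e < 1 &
  forall p, p \in ps -> (p != 0 -> p.[e] != 0) /\ (0 < p.[0] -> 0 < p.[e])].
Proof.
suff [d d0 H] : exists2 d : R, 0 < d & forall e, 0 < e < d -> forall p, p \in ps ->
    (p != 0 -> p.[e] != 0) /\ (0 < p.[0] -> 0 < p.[e]).
  have m0 : 0 < Num.min d 1 by rewrite lt_min d0 ltr01.
  have m1 : Num.min d 1 <= d by rewrite ge_min lexx.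
  have m2 : Num.min d 1 <= 1 by rewrite ge_min lexx orbT.
  exists (Num.min d 1 / 2); split; [lra|lra|apply: H; lra].
elim: ps => [|p ps [d d0 IH]]; first by exists 1.
suff [d' d'0 H'] : exists2 d' : R, 0 < d' & forall e, 0 < e < d' ->
    (p != 0 -> p.[e] != 0) /\ (0 < p.[0] -> 0 < p.[e]).
  exists (Num.min d d'); first by rewrite lt_min d0 d'0.
  move=> e; rewrite lt_min andbA => /andP[/andP[e0 e1] e2] q.
  rewrite inE => /predU1P[->|]; first by apply: H'; rewrite e0.
  by apply: IH; rewrite e0.
have [->|p0] := eqVneq p 0; first by exists 1; rewrite ?ltr01 // => e _; rewrite !horner0 ltxx eqxx; split.
have [n [q /implyP/(_ p0) q0 pE]] := multiplicity_XsubC p 0.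
have [d1 d10 H1] := poly_sign_near0 q0.
exists d1 => // e He; have := H1 e He; have /andP[e0 _] := He => qq.
have qe : q.[e] != 0 by apply/eqP => h; move: qq; rewrite h mul0r ltxx.
rewrite pE !hornerM !horner_exp !hornerXsubC !subr0; split => [_|].
  by rewrite mulf_neq0 // expf_neq0 // gt_eqF.
case: n pE => [|n] pE; last by rewrite expr0n /= mulr0 ltxx.
by rewrite !expr0 !mulr1 => h; rewrite pmulr_lgt0 // in qq.
Qed.

Lemma seq_max (T : eqType) (f : T -> R) (P : T -> Prop) (s : seq T) :
  (exists2 x, x \in s & P x) ->
  exists x, [/\ x \in s, P x & forall y, y \in s -> P y -> f y <= f x].
Proof.
elim: s => [[x]//|a s IH] [x xs Px].
have [[y ys Py]|H] := pselect (exists2 y, y \in s & P y).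
  have [z [zs Pz Hz]] := IH (ex_intro2 _ _ y ys Py).
  have [[Pa az]|na] := pselect (P a /\ f z <= f a).
    exists a; split; rewrite ?inE ?eqxx // => w.
    rewrite inE => /predU1P[-> //|ws Pw]; exact: le_trans (Hz _ ws Pw) az.
  exists z; split; rewrite ?inE ?zs ?orbT // => w.
  rewrite inE => /predU1P[-> Pa|]; last exact: Hz.
  by rewrite leNgt; apply/negP => /ltW h; apply: na.
exists x; split => // y; move: xs; rewrite !inE => /predU1P[->|xs]; last first.
  by case: H; exists x.
by move=> /predU1P[-> //|ys Py]; case: H; exists y.
Qed.

(** The ratio test of the simplex method: moving from [a] in the direction [d], stop
at the first coordinate that reaches zero. *)
Lemma ratio_test (T : eqType) (s : seq T) (a d : T -> R) :
  (forall m, m \in s -> 0 <= a m) -> (exists2 m, m \in s & d m < 0) ->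
  exists k r, [/\ k \in s, d k < 0, 0 <= r, a k + r * d k = 0 &
    forall m, m \in s -> 0 <= a m + r * d m].
Proof.
move=> a0 /(seq_max (fun m => a m / d m))[k [ks dk kmax]].
have dk' : d k != 0 by rewrite lt_eqF.
exists k, (- (a k / d k)); split => //.
- by rewrite oppr_ge0 mulr_ge0_le0 ?a0 // invr_le0 ltW.
- by field.
- move=> m ms; have am := a0 _ ms.
  have r0 : 0 <= - (a k / d k).
    by rewrite oppr_ge0 mulr_ge0_le0 ?a0 // invr_le0 ltW.
  have [dm|dm] := leP 0 (d m); first by rewrite addr_ge0 // mulr_ge0.
  have := kmax _ ms dm; rewrite ler_ndivrMr // mulNr.
  by rewrite subr_ge0.
Qed.

Implicit Types (x y z p q v : R * R) (L h s : R * R -> R).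
Implicit Types (t u A B V : {fset (R * R)}) (T : {fset {fset (R * R)}}).

(** * Affine functions and barycentric coordinates *)

Definition affine L : Prop :=
  exists a b c : R, forall x, L x = a * x.1 + b * x.2 + c.

Lemma affine_comb L (s : seq (R * R)) (w : R * R -> R) x : affine L ->
  \sum_(v <- s) w v = 1 -> x = \sum_(v <- s) w v *: v ->
  L x = \sum_(v <- s) w v * L v.
Proof.
move=> [a [b [c HL]]] w1 ->.
rewrite HL.
rewrite [RHS](eq_bigr (fun v => w v * (a * v.1) + w v * (b * v.2) + w v * c));
  last by move=> v _; rewrite HL !mulrDr.
rewrite !big_split /= -mulr_suml w1 mul1r; congr (_ + _ + _).
- rewrite (big_morph fst (id1 := 0) (op1 := +%R)) // mulr_sumr.
  by apply: eq_bigr => i _; rewrite /= mulrCA.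
- rewrite (big_morph snd (id1 := 0) (op1 := +%R)) // mulr_sumr.
  by apply: eq_bigr => i _; rewrite /= mulrCA.
Qed.

Lemma affine_seg L x y (r : R) : affine L ->
  L (x + r *: (y - x)) = L x + r * (L y - L x).
Proof.
move=> [a [b [c HL]]]; rewrite !HL.
change ((x + r *: (y - x)).1) with (x.1 + r * (y.1 - x.1)).
change ((x + r *: (y - x)).2) with (x.2 + r * (y.2 - x.2)).
ring.
Qed.

Lemma affine_sum (I : Type) (s : seq I) (P : pred I) (F : I -> R * R -> R) :
  (forall i, affine (F i)) -> affine (fun x => \sum_(i <- s | P i) F i x).
Proof.
move=> HF; elim: s => [|i s [a [b [c IH]]]].
  by exists 0, 0, 0 => x; rewrite big_nil; ring.
have [a' [b' [c' H]]] := HF i; case Pi : (P i).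
  exists (a + a'), (b + b'), (c + c') => x.
  by rewrite big_cons Pi IH H; ring.
by exists a, b, c => x; rewrite big_cons Pi IH.
Qed.

Lemma affine_scale L (r : R) : affine L -> affine (fun x => L x * r).
Proof.
move=> [a [b [c H]]]; exists (a * r), (b * r), (c * r) => x.
by rewrite H; ring.
Qed.

(** Twice the signed area of the triangle [x y z]. *)
Definition det3 x y z : R :=
  (y.1 - x.1) * (z.2 - x.2) - (y.2 - x.2) * (z.1 - x.1).

Lemma affine_det3 y z : affine (fun x => det3 x y z).
Proof.
exists (y.2 - z.2), (z.1 - y.1), (y.1 * z.2 - y.2 * z.1) => x.
by rewrite /det3; ring.
Qed.

Definition triangle t : Prop := #|` t| = 3%N /\ ~ collinear t.

(** Barycentric coordinates as a quotient of sums over all pairs of vertices,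
which avoids choosing an order on [t].  For [t = {v, a, b}] only the pairs
[(a, b)] and [(b, a)] contribute, and the quotient is
[det3 x a b / det3 v a b]. *)
Definition bary t x v : R :=
  (\sum_(a <- t) \sum_(b <- t) det3 x a b * det3 v a b) /
  (\sum_(a <- t) \sum_(b <- t) det3 v a b ^+ 2).

Definition interp h t x : R := \sum_(v <- t) bary t x v * h v.

Lemma affine_bary t v : affine (bary t ^~ v).
Proof.
apply: affine_scale; apply: affine_sum => a; apply: affine_sum => b.
exact/affine_scale/affine_det3.
Qed.

Lemma affine_interp h t : affine (interp h t).
Proof. by apply: affine_sum => v; apply/affine_scale/affine_bary. Qed.

Lemma card3P t : #|` t| = 3%N ->
  exists a b c, [/\ a != b, a != c, b != c & t = [fset a; b; c]%fset].
Proof.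
move=> ht.
have /fset0Pn[a ta] : t != fset0 by rewrite -cardfs_gt0 ht.
have := cardfsD1 a t; rewrite ta ht add1n => -[] h1.
have /fset0Pn[b tb] : (t `\ a)%fset != fset0 by rewrite -cardfs_gt0 -h1.
have := cardfsD1 b (t `\ a)%fset; rewrite tb -h1 add1n => -[] /esym/eqP/cardfs1P[c hc].
have : c \in (t `\ a `\ b)%fset by rewrite hc inE.
rewrite !in_fsetD1 => /and3P[cb ca tc].
move: tb; rewrite in_fsetD1 => /andP[ba tb].
exists a, b, c; split; rewrite 1?eq_sym //.
apply/fsetP => z; rewrite !inE.
have := erefl (z \in (t `\ a `\ b)%fset); rewrite {1}hc !inE.
case: (eqVneq z a) => [->|za]; first by rewrite ta.
by case: (eqVneq z b) => [->|zb]; rewrite ?tb //= => ->.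
Qed.

Lemma sum3 (M : nmodType) (a b c : R * R) (F : R * R -> M) :
  a != b -> a != c -> b != c ->
  \sum_(v <- [fset a; b; c]%fset) F v = F a + F b + F c.
Proof.
move=> ab ac bc.
have -> : [fset a; b; c]%fset = (c |` (b |` [fset a]))%fset.
  by apply/fsetP => z; rewrite !inE; case: (z == a); case: (z == b); case: (z == c).
rewrite big_fsetU1 ?inE ?negb_or; last by rewrite eq_sym bc eq_sym ac.
rewrite big_fsetU1 ?inE; last by rewrite eq_sym.
by rewrite big_seq_fset1 /= addrC [F b + _]addrC.
Qed.

Lemma collinear_det3 A (a b : R * R) : a != b ->
  (forall z, z \in A -> det3 a b z = 0) -> collinear A.
Proof.
move=> ab H; exists (a.2 - b.2), (b.1 - a.1), (b.1 * a.2 - b.2 * a.1); split.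
  case=> h1 h2; case/negP: ab; apply/eqP.
  by apply: injective_projections; lra.
by move=> z /H; rewrite /det3; lra.
Qed.

Lemma det3_neq0 (a b c : R * R) : a != b ->
  ~ collinear [fset a; b; c]%fset -> det3 a b c != 0.
Proof.
move=> ab; apply: contra_notN => /eqP d0.
apply: (collinear_det3 ab) => z.
by rewrite !inE => /orP[/orP[]|] /eqP -> //; rewrite /det3; ring.
Qed.

Lemma bary3 (a b c : R * R) x : a != b -> a != c -> b != c ->
  det3 a b c != 0 ->
  let t := [fset a; b; c]%fset in
  [/\ bary t x a = det3 x b c / det3 a b c,
      bary t x b = det3 a x c / det3 a b c &
      bary t x c = det3 a b x / det3 a b c].
Proof.
move=> ab ac bc d0 t; rewrite /bary /t !sum3 //.
have e1 v w : det3 v w v = 0 by rewrite /det3; ring.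
have e2 v w : det3 v v w = 0 by rewrite /det3; ring.
have e3 v w : det3 v w w = 0 by rewrite /det3; ring.
have s1 v y z : det3 v y z = - det3 v z y by rewrite /det3; ring.
rewrite !(e1, e2, e3) !(mulr0, mul0r, expr0n, add0r, addr0) /=.
rewrite (s1 x c b) (s1 a c b) (s1 x c a) (s1 b c a) (s1 x b a) (s1 c b a).
have -> : det3 b a c = - det3 a b c by rewrite /det3; ring.
have -> : det3 c a b = det3 a b c by rewrite /det3; ring.
have -> : det3 a x c = - det3 x a c by rewrite /det3; ring.
have -> : det3 a b x = det3 x a b by rewrite /det3; ring.
have sq : det3 a b c ^+ 2 + (- det3 a b c) ^+ 2 != 0.
  by rewrite sqrrN -mulr2n mulrn_eq0 /= expf_eq0.
rewrite !opprK !sqrrN in sq *.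
by split; field; rewrite d0.
Qed.

Lemma baryP t : triangle t -> forall x,
  \sum_(v <- t) bary t x v = 1 /\ x = \sum_(v <- t) bary t x v *: v.
Proof.
move=> [/card3P[a [b [c [ab ac bc ->]]]] ht] x.
have d0 := det3_neq0 ab ht.
rewrite !sum3 //; have [-> -> ->] := bary3 x ab ac bc d0.
have d0' := d0; rewrite /det3 in d0'.
have s1 (r : R) y : (r *: y).1 = r * y.1 by [].
have s2 (r : R) y : (r *: y).2 = r * y.2 by [].
split; first by rewrite /det3; field.
have s3 y z : (y + z).1 = y.1 + z.1 by [].
have s4 y z : (y + z).2 = y.2 + z.2 by [].
by apply: injective_projections; rewrite ?(s3, s4) ?(s1, s2) /det3; field.
Qed.

Lemma sum_bary t x : triangle t -> \sum_(v <- t) bary t x v = 1.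
Proof. by move=> /baryP/(_ x)[]. Qed.

Lemma bary_vertex t a b : triangle t -> a \in t -> b \in t ->
  bary t a b = (a == b)%:R.
Proof.
move=> [/card3P[u [v [w [uv uw vw ->]]]] ht].
have d0 := det3_neq0 uv ht.
have E x := bary3 x uv uw vw d0.
have z1 y z : det3 y z z = 0 by rewrite /det3; ring.
have z2 y z : det3 y y z = 0 by rewrite /det3; ring.
have z3 y z : det3 y z y = 0 by rewrite /det3; ring.
have [u1 u2 u3] := E u; have [v1 v2 v3] := E v; have [w1 w2 w3] := E w.
have [vu wu wv] : [/\ v != u, w != u & w != v] by split; rewrite eq_sym.
rewrite !inE => /orP[/orP[]|] /eqP -> /orP[/orP[]|] /eqP ->;
  rewrite ?eqxx ?(negbTE uv) ?(negbTE uw) ?(negbTE vw) ?(negbTE vu) ?(negbTE wu)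
    ?(negbTE wv) ?(u1, u2, u3) ?(v1, v2, v3) ?(w1, w2, w3) ?(z1, z2, z3) ?mul0r
    ?divff //.
Qed.

Lemma affine_interpE L t x : triangle t -> affine L ->
  L x = \sum_(v <- t) bary t x v * L v.
Proof. by move=> /baryP/(_ x)[w1 wx] aL; apply: (affine_comb aL). Qed.

Lemma bary_unique t (w : R * R -> R) x : triangle t ->
  \sum_(v <- t) w v = 1 -> x = \sum_(v <- t) w v *: v ->
  forall v, v \in t -> bary t x v = w v.
Proof.
move=> tt w1 wx v vt.
rewrite (affine_comb (affine_bary t v) w1 wx) (big_fsetD1 v) //=.
rewrite bary_vertex // eqxx mulr1 big_seq_cond big1 ?addr0 // => i.
rewrite andbT in_fsetD1 => /andP[iv it].
by rewrite bary_vertex // (negbTE iv) mulr0.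
Qed.

Lemma interp_unique h t (w : R * R -> R) x : triangle t ->
  \sum_(v <- t) w v = 1 -> x = \sum_(v <- t) w v *: v ->
  interp h t x = \sum_(v <- t) w v * h v.
Proof.
move=> tt w1 wx; rewrite /interp big_seq_cond [RHS]big_seq_cond.
apply: eq_bigr => v; rewrite andbT => vt.
by rewrite (bary_unique tt w1 wx).
Qed.

Lemma interp_vertex h t v : triangle t -> v \in t -> interp h t v = h v.
Proof.
move=> tt vt; rewrite /interp (big_fsetD1 v) //= bary_vertex // eqxx mul1r.
rewrite big_seq_cond big1 ?addr0 // => i; rewrite andbT in_fsetD1 => /andP[iv it].
by rewrite bary_vertex // eq_sym (negbTE iv) mul0r.
Qed.

Lemma hullP t x : triangle t ->
  hull t x <-> (forall v, v \in t -> 0 <= bary t x v).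
Proof.
move=> tt; split => [[w [w0 w1 wx]] v vt|H].
  by rewrite (bary_unique tt w1 wx) // w0.
by have [b1 bx] := baryP tt x; exists (bary t x); split.
Qed.

Lemma sum_fset_incl (M : nmodType) A B (F : R * R -> M) : (A `<=` B)%fset ->
  \sum_(v <- B) (if v \in A then F v else 0) = \sum_(v <- A) F v.
Proof.
move=> AB; rewrite -(big_fset_incl _ AB) /=.
  by rewrite big_seq_cond [RHS]big_seq_cond; apply: eq_bigr => v; rewrite andbT => ->.
by move=> v _ /negbTE ->.
Qed.

Lemma hullS A B : (A `<=` B)%fset -> hull A `<=` hull B.
Proof.
move=> AB x [w [w0 w1 wx]]; exists (fun v => if v \in A then w v else 0); split.
- by move=> v _; case: ifP => // /w0.
- by rewrite (sum_fset_incl _ AB).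
- rewrite wx -(sum_fset_incl _ AB); apply: eq_bigr => v _.
  by case: ifP; rewrite ?scale0r.
Qed.

(** The coordinates in [t] of a point in the hull of a face of [t] are its weights
on that face, extended by zero. *)
Lemma bary_subhull t A x : triangle t -> (A `<=` t)%fset -> hull A x ->
  forall v, v \in t -> bary t x v != 0 -> v \in A.
Proof.
move=> tt At [w [w0 w1 wx]] v vt; apply: contraNT => vA.
rewrite (@bary_unique t (fun v => if v \in A then w v else 0)) //.
- by rewrite (negbTE vA).
- by rewrite (sum_fset_incl _ At).
- rewrite wx -(sum_fset_incl _ At); apply: eq_bigr => z _.
  by case: ifP; rewrite ?scale0r.
Qed.

Lemma hull_vertex A v : v \in A -> hull A v.
Proof.
move=> vA; exists (fun z => (z == v)%:R); split => [z _||].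
- by rewrite ler0n.
- rewrite (big_fsetD1 v) //= eqxx big_seq_cond big1 ?addr0 // => i.
  by rewrite andbT in_fsetD1 => /andP[/negbTE ->].
- rewrite (big_fsetD1 v) //= eqxx scale1r big_seq_cond big1 ?addr0 // => i.
  by rewrite andbT in_fsetD1 => /andP[/negbTE -> _]; rewrite scale0r.
Qed.

Lemma hull_seg A x y (r : R) : 0 <= r <= 1 -> hull A x -> hull A y ->
  hull A (x + r *: (y - x)).
Proof.
move=> /andP[r0 r1] [w [w0 w1 wx]] [z [z0 z1 zy]].
exists (fun v => (1 - r) * w v + r * z v); split.
- move=> v vA; rewrite addr_ge0 // mulr_ge0 ?subr_ge0 ?w0 ?z0 //.
- by rewrite big_split /= -!mulr_sumr w1 z1; ring.
- under eq_bigr do rewrite scalerDl -!scalerA.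
  rewrite big_split /= -!scaler_sumr -wx -zy.
  by rewrite scalerBr scalerBl scale1r addrCA addrC [RHS]addrC -addrA [r *: y + _]addrC addrA.
Qed.

(** * General position and common edges *)

(** General position inside the hull: [p] is moved towards a point of [t] along a
cubic curve that leaves every line, so finitely many affine functions become
nonzero while the positive ones stay positive. *)
Lemma generic_point t (p : R * R) (I : eqType) (s : seq I)
    (F : I -> R * R -> R) : triangle t -> (forall i, affine (F i)) ->
  exists (e : R) y, [/\ 0 <= e <= 1, hull t y &
    forall i, i \in s ->
      ((exists2 z, z \in t & F i z != 0) -> F i (p + e *: (y - p)) != 0) /\
      (0 < F i p -> 0 < F i (p + e *: (y - p)))].
Proof.
move=> [/card3P[a [b [c [ab ac bc tE]]]] _] HF.
(* [P i] is [F i] along [p + e (a - p) + e^2 (b - a) + e^3 (c - b)]; it is zero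
   only if [F i] vanishes at [p] and at all three vertices. *)
pose P i := Poly [:: F i p; F i a - F i p; F i b - F i a; F i c - F i b].
have [e [e0 e1 He]] := small_param [seq P i | i <- s].
have e01 : 0 <= e <= 1 by rewrite !ltW.
exists e, (a + e *: (b + e *: (c - b) - a)); split => //.
  by do 2?apply: hull_seg => //; apply: hull_vertex; rewrite tE !inE eqxx ?orbT.
move=> i /(map_f P)/He[h1 h2].
have PE (x : R) : (P i).[x] = F i p + x * (F i a + x * (F i b + x * (F i c - F i b)
    - F i a) - F i p) by rewrite /P horner_Poly /=; ring.
rewrite !(affine_seg _ _ _ (HF i)) -PE; split.
  move=> [z]; rewrite tE => zt Fz; apply: h1; apply: contra_neq Fz => P0.
  have C j : (P i)`_j = 0 by rewrite P0 coef0.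
  have := (C 0%N, C 1%N, C 2%N, C 3%N); rewrite !coef_Poly /=.
  move=> [[[c0 c1] c2] c3].
  by move: zt; rewrite !inE => /orP[/orP[]|] /eqP ->; lra.
move=> h0; apply: h2; rewrite PE; move: h0; lra.
Qed.

Lemma seg_small (q v : R * R) (I : eqType) (s : seq I)
    (F : I -> R * R -> R) : (forall i, affine (F i)) ->
  exists e : R, [/\ 0 < e, e < 1 &
    forall i, i \in s -> 0 < F i q -> 0 < F i (q + e *: (v - q))].
Proof.
move=> HF; pose P i := Poly [:: F i q; F i v - F i q].
have [e [e0 e1 He]] := small_param [seq P i | i <- s].
exists e; split => // i /(map_f P)/He[_ h2] h0.
have PE (x : R) : (P i).[x] = F i q + x * (F i v - F i q).
  by rewrite /P horner_Poly /=; ring.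
by rewrite (affine_seg _ _ _ (HF i)) -PE; apply: h2; rewrite PE; move: h0; lra.
Qed.

Lemma affineN L : affine L -> affine (fun x => - L x).
Proof.
by move=> [a [b [c H]]]; exists (-a), (-b), (-c) => x; rewrite H; ring.
Qed.

Lemma not_hull t x : triangle t -> ~ hull t x ->
  exists2 v, v \in t & bary t x v < 0.
Proof.
move=> tt nh; apply: contrapT => H; apply: nh; apply/hullP => // v vt.
by rewrite leNgt; apply/negP => h; apply: H; exists v.
Qed.

Lemma triangulation_triangle V T t : triangulation V T -> t \in T ->
  triangle t /\ (t `<=` V)%fset.
Proof. by move=> [+ _ _ _] => /[apply] -[]. Qed.

Lemma card_edge t k : triangle t -> k \in t -> #|` (t `\ k)%fset| = 2%N.
Proof. by move=> [t3 _] kt; have := cardfsD1 k t; rewrite kt t3 add1n => -[]. Qed.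

(** An affine function that vanishes at [v] and on the edge [t minus k] takes at [v]
the value [bary t v k] times its value at [k], so it vanishes at [k] as well. *)
Lemma triangle_swap t k v : triangle t -> k \in t -> bary t v k != 0 ->
  triangle (v |` (t `\ k))%fset /\ v \notin (t `\ k)%fset.
Proof.
move=> tt kt bk.
have vn : v \notin (t `\ k)%fset.
  rewrite in_fsetD1; apply: contra_neqN bk => /andP[vk vt].
  by rewrite bary_vertex // (negbTE vk).
split => //; split; first by rewrite cardfsU1 vn card_edge.
move=> [a [b [c [ab H]]]]; case: (tt) => _; apply.
exists a, b, c; split => // z zt.
have [-> {z zt}|zk] := eqVneq z k; last first.
  by apply: H; rewrite !inE zk zt orbT.
pose L x := a * x.1 + b * x.2 - c.
have aL : affine L by exists a, b, (- c) => x.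
have := H v; rewrite !inE eqxx => /(_ isT)/eqP; rewrite -subr_eq0.
rewrite -/(L v) (affine_interpE v tt aL) (big_fsetD1 k) //= big_seq_cond big1.
  by rewrite addr0 mulf_eq0 (negbTE bk) /= subr_eq0 => /eqP.
move=> i; rewrite andbT => it.
have Hi : i \in (v |` (t `\ k))%fset by rewrite inE it orbT.
by rewrite /L (H i Hi) subrr mulr0.
Qed.

(** Both sides are affine in [x], vanish on the common edge, and agree at [l]. *)
Lemma bary_swap t k l x : triangle t -> k \in t ->
  triangle (l |` (t `\ k))%fset ->
  bary t x k = bary (l |` (t `\ k))%fset x l * bary t l k.
Proof.
move=> tt kt tt'.
have ln : l \notin (t `\ k)%fset.
  by case: tt' => + _; rewrite cardfsU1 card_edge //; case: (l \notin _).
rewrite {1}(affine_interpE x tt' (affine_bary t k)) big_fsetU1 //=.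
rewrite big_seq_cond big1 ?addr0 // => i.
rewrite andbT in_fsetD1 => /andP[ik it].
by rewrite (bary_vertex tt it kt) (negbTE ik) mulr0.
Qed.

(** The barycenter of the face [A]. *)
Lemma face_center t A : triangle t -> (A `<=` t)%fset -> A != fset0 ->
  exists q, [/\ hull A q, forall v, v \in A -> 0 < bary t q v &
    forall v, v \in t -> v \notin A -> bary t q v = 0].
Proof.
move=> tt At A0.
pose r : R := (#|` A|%:R)^-1.
have n0 : (#|` A|%:R : R) != 0 by rewrite pnatr_eq0 -lt0n cardfs_gt0.
have r0 : 0 < r by rewrite invr_gt0 lt_def n0 ler0n.
pose w v := if v \in A then r else 0.
have w1 : \sum_(v <- t) w v = 1.
  rewrite (sum_fset_incl _ At) big_const_seq count_predT iter_addr_0 -mulr_natr.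
  by rewrite mulVf.
have H := bary_unique tt w1 erefl.
exists (\sum_(v <- t) w v *: v); split => [|v vA|v vt vA].
- exists w; split => [v vA||]; first by rewrite /w vA ltW.
    by rewrite -w1 -(sum_fset_incl _ At); apply: eq_bigr => v _; rewrite /w; case: (v \in A).
  rewrite -(sum_fset_incl _ At); apply: eq_bigr => v _.
  by rewrite /w; case: (v \in A); rewrite ?scale0r.
- by rewrite H ?(fsubsetP At) // /w vA.
- by rewrite H // /w (negbTE vA).
Qed.

(** Points slightly beyond [q] towards [v] are still in the hull of [V], hence
covered by a triangle other than [t].  A triangle that contains such points
contains [q] too, since finitely many triangles are closed; as [q] is interior
to the edge, that triangle contains both endpoints. *)
Lemma neighbour V T t k q v : triangulation V T -> t \in T -> k \in t ->
  v \in V -> bary t v k < 0 -> bary t q k = 0 ->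
  (forall m, m \in (t `\ k)%fset -> 0 < bary t q m) ->
  exists l, [/\ l \in V, l \notin t, (l |` (t `\ k))%fset \in T &
    bary t l k < 0].
Proof.
move=> trT tT kt vV bv bq bm.
have [H1 H2 H3 H4] := trT.
have [tt tV] := triangulation_triangle trT tT.
have qt : hull t q.
  apply/hullP => // m mt; have [->|mk] := eqVneq m k; first by rewrite bq.
  by rewrite ltW // bm // in_fsetD1 mk.
(* [e] is so small that no triangle missing [q] meets [x]. *)
have [e [e0 e1 He]] := seg_small q v [seq (u, m) | u <- T, m <- V]
  (F := fun um x => - bary um.1 x um.2) (fun um => affineN (affine_bary _ _)).
set x := q + e *: (v - q) in He.
have xV : hull V x.
  apply: hull_seg; rewrite ?(ltW e0) ?(ltW e1) //; first exact: hullS qt.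
  exact: hull_vertex.
rewrite H3 in xV; case: xV => u uT xu.
have [tu uV] := triangulation_triangle trT uT.
have qu : hull u q.
  apply: contrapT => /(not_hull tu)[m mu bm0].
  have := He (u, m); rewrite allpairs_f ?(fsubsetP uV) //= oppr_gt0.
  move=> /(_ isT bm0); rewrite oppr_gt0 ltNge => /negP; apply.
  exact: (hullP _ tu).1.
have bx : bary t x k < 0.
  rewrite (affine_seg _ _ _ (affine_bary t k)) bq add0r subr0.
  by rewrite pmulr_rlt0.
have tu' : hull (t `&` u)%fset q by rewrite -H4.
have sub : (t `\ k `<=` u)%fset.
  apply/fsubsetP => m mt.
  have : m \in (t `&` u)%fset.
    apply: (bary_subhull tt (fsubsetIl _ _) tu').
      exact: (fsubsetP (fsubD1set _ _)) mt.
    by rewrite gt_eqF // bm.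
  by rewrite inE => /andP[].
(* Otherwise [u] would be [t], on whose other side [x] lies. *)
have ku : k \notin u.
  apply/negP => ku.
  have E : t = u.
    apply/eqP; rewrite eqEfcard (proj1 tu) (proj1 tt) leqnn andbT.
    by rewrite -(fsetD1K kt) fsubUset fsub1set ku.
  by move: bx; rewrite ltNge => /negP; apply; apply: (hullP _ tt).1 => //; rewrite E.
have /cardfs1P[l Hl] : #|` (u `\` (t `\ k))%fset| == 1%N.
  by rewrite cardfsDS // card_edge // (proj1 tu).
have uE : u = (l |` (t `\ k))%fset by rewrite -Hl; apply/fsetP => z;
    rewrite in_fsetU in_fsetD; have := fsubsetP sub z;
    by case: (z \in (t `\ k)%fset) => [->|_] //=; rewrite orbF.
have /andP[lnt lu] : (l \notin (t `\ k)%fset) && (l \in u).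
  have : l \in [fset l]%fset by rewrite inE.
  by rewrite -Hl in_fsetD.
exists l; split; rewrite -?uE //; first exact: (fsubsetP uV).
  move: lnt; rewrite in_fsetD1 => /nandP[/negPn/eqP lk|//].
  by rewrite lk in lu; rewrite lu in ku.
have := bary_swap x tt kt; move=> /(_ l); rewrite -uE => /(_ tu) E.
have b0 : 0 <= bary u x l by apply: (hullP _ tu).1.
rewrite E in bx; rewrite ltNge; apply/negP => h.
by have := mulr_ge0 b0 h; rewrite leNgt bx.
Qed.

(** If [k] and [l] were on the same side of their common edge, points near the
midpoint of the edge would lie in both triangles but not on the edge. *)
Lemma edge_opposite V T t k l : triangulation V T -> t \in T -> k \in t ->
  l != k -> (l |` (t `\ k))%fset \in T -> bary t l k < 0.
Proof.
move=> trT tT kt lk t'T; set t' := (l |` (t `\ k))%fset in t'T *.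
have [H1 H2 H3 H4] := trT.
have [tt tV] := triangulation_triangle trT tT.
have [tt' tV'] := triangulation_triangle trT t'T.
have bk : bary t l k != 0.
  apply/eqP => b0; have := bary_swap k tt kt tt'.
  by rewrite b0 mulr0 bary_vertex // eqxx => /eqP; rewrite oner_eq0.
rewrite lt_neqAle bk /= leNgt; apply/negP => bk0.
have A0 : (t `\ k)%fset != fset0 by rewrite -cardfs_gt0 card_edge.
have [q [qA q1 q2]] := face_center tt (fsubD1set t k) A0.
have qk : bary t q k = 0 by rewrite q2 // in_fsetD1 eqxx.
have [e [e0 e1 He]] := seg_small q l (t `\ k)%fset (affine_bary t).
set x := q + e *: (l - q) in He.
have xk : 0 < bary t x k.
  rewrite (affine_seg _ _ _ (affine_bary t k)) qk add0r subr0.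
  by rewrite mulr_gt0 // lt_def bk.
have xt : hull t x.
  apply/hullP => // m mt; have [->|mk] := eqVneq m k; first exact: ltW.
  have mA : m \in (t `\ k)%fset by rewrite in_fsetD1 mk.
  by rewrite ltW // He // q1.
have xt' : hull t' x.
  apply: hull_seg; rewrite ?(ltW e0) ?(ltW e1) //.
    exact: hullS (fsubsetU1 _ _) _ qA.
  by apply: hull_vertex; rewrite inE in_fset1 eqxx.
have xI : hull (t `&` t')%fset x by rewrite -H4.
have := bary_subhull tt (fsubsetIl _ _) xI kt.
by rewrite gt_eqF // => /(_ isT); rewrite !inE eqxx orbF eq_sym (negbTE lk) andbF.
Qed.

Lemma interp_comb h t u x : triangle u ->
  interp h t x = \sum_(v <- u) bary u x v * interp h t v.
Proof. by move=> tu; apply: affine_interpE => //; apply: affine_interp. Qed.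

(** At [p] each of the two affine functions is an average of values of the other one,
replaced by the larger [h].  So they agree at [p], and equality holds at every
vertex of [u] that carries weight. *)
Lemma common_face h t u p : triangle t -> triangle u ->
  (forall v, v \in u -> interp h t v <= h v) ->
  (forall v, v \in t -> interp h u v <= h v) ->
  hull t p -> hull u p ->
  forall v, v \in u -> bary u p v != 0 -> interp h t v = h v.
Proof.
move=> tt tu Htu Hut /(hullP _ tt) pt /(hullP _ tu) pu v vu bv.
have ge0 z : z \in u -> 0 <= bary u p z * (h z - interp h t z).
  by move=> zu; rewrite mulr_ge0 ?pu // subr_ge0 Htu.
have : \sum_(z <- u) bary u p z * (h z - interp h t z) <= 0.
  under eq_bigr do rewrite mulrBr.
  rewrite sumrB -interp_comb // -/(interp h u p) subr_le0 (interp_comb h u p tt).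
  rewrite /interp big_seq [leRHS]big_seq; apply: ler_sum => z zt.
  by rewrite ler_wpM2l ?pt ?Hut.
have Hs := sumr_ge0 _ ge0.
rewrite big_seq => le0.
have : \sum_(z <- u | z \in u) bary u p z * (h z - interp h t z) == 0.
  by rewrite eq_le le0 Hs.
rewrite psumr_eq0 // => /allP/(_ v vu); rewrite vu mulf_eq0 (negbTE bv) /=.
by rewrite subr_eq0 => /eqP.
Qed.

(** The two affine functions differ only through the vertex [l]. *)
Lemma interp_neighbour h t k l v : triangle t -> k \in t ->
  triangle (l |` (t `\ k))%fset ->
  interp h (l |` (t `\ k))%fset v =
  interp h t v + bary (l |` (t `\ k))%fset v l * (h l - interp h t l).
Proof.
move=> tt kt tt'.
have ln : l \notin (t `\ k)%fset.
  by case: tt' => + _; rewrite cardfsU1 card_edge //; case: (l \notin _).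
apply/eqP; rewrite addrC -subr_eq (interp_comb h t v tt') {1}/interp -sumrB.
rewrite big_fsetU1 //= [X in _ + X]big_seq_cond [X in _ + X]big1 => [|z].
  by rewrite addr0 -mulrBr.
rewrite andbT in_fsetD1 => /andP[_ zt].
by rewrite (interp_vertex h tt zt) subrr.
Qed.

Lemma hull_supp t A x : triangle t -> (A `<=` t)%fset -> hull t x ->
  (forall v, v \in t -> bary t x v != 0 -> v \in A) -> hull A x.
Proof.
move=> tt At /(hullP _ tt) xt H; have [b1 bx] := baryP tt x.
have E v : v \in t -> bary t x v = if v \in A then bary t x v else 0.
  by move=> vt; case: ifPn => // vA; apply: contraNeq vA; apply: H.
exists (bary t x); split => [v vA||].
- by rewrite xt // (fsubsetP At).
- rewrite -{1}b1 -(sum_fset_incl _ At) big_seq [RHS]big_seq.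
  by apply: eq_bigr => v vt; rewrite -E.
- rewrite {1}bx -(sum_fset_incl _ At) big_seq [RHS]big_seq.
  by apply: eq_bigr => v vt; rewrite {1}E //; case: ifP => // _; rewrite scale0r.
Qed.

Lemma bary_face t u A x : triangle t -> triangle u ->
  (A `<=` t)%fset -> (A `<=` u)%fset -> hull A x ->
  forall v, v \in A -> bary t x v = bary u x v.
Proof.
move=> tt tu At Au [w [w0 w1 wx]].
have H (z : {fset (R * R)}) v : triangle z -> (A `<=` z)%fset -> v \in A -> bary z x v = w v.
  move=> tz Az vA; rewrite (@bary_unique z (fun v => if v \in A then w v else 0)) //.
  - by rewrite vA.
  - by rewrite (sum_fset_incl _ Az).
  - rewrite wx -(sum_fset_incl _ Az); apply: eq_bigr => z' _.
    by case: ifP; rewrite ?scale0r.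
  - exact: (fsubsetP Az).
by move=> v vA; rewrite !H.
Qed.

(** * Exchanging a vertex *)

(** Mass can be moved from [t] onto [v], with the barycenter fixed, until a vertex
[k] of [t] is exhausted; that vertex has positive coordinate, so [v] can replace
it in the triangle. *)
Lemma pivot t v (a : R * R -> R) : triangle t ->
  (forall m, m \in t -> 0 <= a m) ->
  exists k r, [/\ k \in t, 0 < bary t v k, 0 <= r, a k = r * bary t v k &
    forall m, m \in t -> r * bary t v m <= a m].
Proof.
move=> tt a0.
have H : exists2 m, m \in t & - bary t v m < 0.
  apply: contrapT => H; have := sum_bary v tt; apply/eqP.
  rewrite lt_eqF //; apply: le_lt_trans ltr01; rewrite big_seq.
  apply: sumr_le0 => m mt; rewrite leNgt; apply/negP => bm; apply: H.
  by exists m; rewrite // oppr_lt0.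
have [k [r [kt dk r0 ak Hm]]] := ratio_test a0 H.
exists k, r; split => //.
- by rewrite -oppr_lt0.
- by apply/eqP; rewrite -subr_eq0 -mulrN; apply/eqP.
- by move=> m mt; rewrite -subr_ge0 -mulrN Hm.
Qed.

(** The weights after the exchange of [k] for [v], tested against any function [f].
The last term vanishes for affine [f]; for a height function it is the
change in height. *)
Lemma pivot_sum (M : lmodType R) t k v (a : R * R -> R) (r w : R)
    (f : R * R -> M) :
  k \in t -> a k = r * bary t v k -> v \notin (t `\ k)%fset ->
  \sum_(z <- (v |` (t `\ k))%fset)
     (if z == v then w + r else a z - r * bary t v z) *: f z =
  w *: f v + \sum_(z <- t) a z *: f z +
  r *: (f v - \sum_(z <- t) bary t v z *: f z).
Proof.
move=> kt ak vn; rewrite big_fsetU1 //= eqxx.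
rewrite [X in _ + X](_ : _ = \sum_(z <- t) (a z - r * bary t v z) *: f z).
  under [X in _ + X]eq_bigr do rewrite scalerBl -scalerA.
  rewrite sumrB -scaler_sumr scalerDl scalerBr.
  by rewrite [RHS]addrA -[in RHS]addrA -[in RHS]addrA addrACA -!addrA; congr (_ + _);
   rewrite addrCA.
rewrite [RHS](big_fsetD1 k) //= ak subrr scale0r add0r.
rewrite big_seq [RHS]big_seq; apply: eq_bigr => z zt.
by rewrite ifN //; apply: contraNneq vn => <-.
Qed.

Lemma baryE t x : triangle t -> x = \sum_(z <- t) bary t x z *: z.
Proof. by move=> /baryP/(_ x)[]. Qed.

Lemma pivot_mass t k v (a : R * R -> R) (r w : R) : triangle t ->
  k \in t -> a k = r * bary t v k -> v \notin (t `\ k)%fset ->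
  \sum_(z <- (v |` (t `\ k))%fset)
     (if z == v then w + r else a z - r * bary t v z) =
  w + \sum_(z <- t) a z.
Proof.
move=> tt kt ak vn.
have E (A : {fset (R * R)}) (F : R * R -> R) :
    \sum_(z <- A) F z *: (1 : R^o) = \sum_(z <- A) F z.
  by apply: eq_bigr => z _; rewrite -[RHS]mulr1.
have := pivot_sum w (fun=> 1 : R^o) kt ak vn.
rewrite !E (sum_bary v tt) subrr scaler0 addr0 => ->.
by congr (_ + _); rewrite -[RHS]mulr1.
Qed.

(** Weights are not normalised, so that the points of [c] can be added one at
a time, each addition being one pivot. *)
Lemma conic_caratheodory V t0 (c : seq (R * R)) (w : R * R -> R) :
  triangle t0 -> (t0 `<=` V)%fset -> {subset c <= V} ->
  (forall v, v \in c -> 0 <= w v) ->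
  exists t (a : R * R -> R), [/\ triangle t, (t `<=` V)%fset,
    forall m, m \in t -> 0 <= a m,
    \sum_(z <- t) a z = \sum_(z <- c) w z &
    \sum_(z <- t) a z *: z = \sum_(z <- c) w z *: z].
Proof.
move=> tt0 t0V; elim: c => [|v c IH] cV w0.
  exists t0, (fun=> 0); split => //; rewrite big_nil big1 // => z _.
  by rewrite scale0r.
have [||t [a [tt tV a0 a1 ax]]] := IH.
- by move=> z zc; apply: cV; rewrite inE zc orbT.
- by move=> z zc; apply: w0; rewrite inE zc orbT.
have [k [r [kt bk r0 ak Hm]]] := pivot v tt a0.
have [tt' vn] := triangle_swap tt kt (lt0r_neq0 bk).
exists (v |` (t `\ k))%fset,
  (fun z => if z == v then w v + r else a z - r * bary t v z); split => //.
- rewrite fsubUset fsub1set cV ?inE ?eqxx //=.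
  exact: fsubset_trans (fsubD1set _ _) tV.
- move=> m; rewrite in_fset1U; case: eqP => /= [_ _|_ /(fsubsetP (fsubD1set _ _)) mt].
    by rewrite addr_ge0 // w0 // inE eqxx.
  by rewrite subr_ge0 Hm.
- by rewrite pivot_mass // big_cons a1.
- have := pivot_sum (w v) id kt ak vn => /= ->.
  by rewrite -(baryE v tt) subrr scaler0 addr0 ax big_cons.
Qed.

Lemma caratheodory V t0 x : triangle t0 -> (t0 `<=` V)%fset -> hull V x ->
  exists t, [/\ triangle t, (t `<=` V)%fset & hull t x].
Proof.
move=> tt0 t0V [w [w0 w1 wx]].
have [//|//|t [a [tt tV a0 a1 ax]]] := @conic_caratheodory V t0 V w tt0 t0V.
by exists t; split => //; exists a; split; rewrite // ?a1 ?ax.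
Qed.

(** Among the triangles containing [p], take one whose interpolated height at [p] is
least.  A point of [V] lifted below its plane could be exchanged for one of its
vertices; by genericity a positive mass is moved, so the height would drop. *)
Lemma lower_cover_generic h V t0 p : triangle t0 -> (t0 `<=` V)%fset ->
  hull V p ->
  (forall t m, triangle t -> (t `<=` V)%fset -> m \in t -> bary t p m != 0) ->
  exists t, [/\ triangle t, (t `<=` V)%fset, hull t p &
    forall v, v \in V -> interp h t v <= h v].
Proof.
move=> tt0 t0V Vp gen.
pose P t := [/\ triangle t, (t `<=` V)%fset & hull t p].
have : exists2 t, t \in fpowerset V & P t.
  have [t [tt tV tp]] := caratheodory tt0 t0V Vp.
  by exists t; rewrite ?fpowersetE.
move=> /(seq_max (fun t => - interp h t p))[t [_ [tt tV tp] tmax]].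
exists t; split => // v vV; rewrite leNgt; apply/negP => hv.
have a0 m : m \in t -> 0 < bary t p m.
  by move=> mt; rewrite lt_def gen //=; apply: (hullP p tt).1.
have [k [r [kt bk r0 ak Hm]]] := pivot v tt (fun m mt => ltW (a0 m mt)).
have {}r0 : 0 < r.
  by have := a0 _ kt; rewrite ak pmulr_lgt0.
have [tt' vn] := triangle_swap tt kt (lt0r_neq0 bk).
pose a' z := if z == v then 0 + r else bary t p z - r * bary t v z.
have a'1 : \sum_(z <- (v |` (t `\ k))%fset) a' z = 1.
  by rewrite pivot_mass // add0r (sum_bary p tt).
have a'x : p = \sum_(z <- (v |` (t `\ k))%fset) a' z *: z.
  have := pivot_sum 0 id kt ak vn => /= ->.
  by rewrite -!(baryE _ tt) subrr scaler0 addr0 scale0r add0r.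
have t'V : (v |` (t `\ k) `<=` V)%fset.
  by rewrite fsubUset fsub1set vV (fsubset_trans (fsubD1set _ _) tV).
(* The exchanged triangle still contains [p], below the old one. *)
have t'p : hull (v |` (t `\ k))%fset p.
  exists a'; split => // m; rewrite in_fset1U /a'.
  case: eqP => /= [_ _|_ /(fsubsetP (fsubD1set _ _)) mt]; first by rewrite add0r ltW.
  by rewrite subr_ge0 Hm.
have := tmax (v |` (t `\ k))%fset; rewrite fpowersetE t'V.
move=> /(_ isT (And3 tt' t'V t'p)); rewrite lerN2 (interp_unique h tt' a'1 a'x) leNgt => /negP; apply.
have := pivot_sum 0 (h : R * R -> R^o) kt ak vn => /= ->.
rewrite scale0r add0r -[X in _ < X]addr0 ltrD2l pmulr_rlt0 // subr_lt0.
exact: hv.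
Qed.

(** * Triangulations from lower convex hulls *)

(** A nonzero linear form vanishes on both edge vectors, which are then parallel. *)
Lemma det3_affine_zero (a b c : R) x y z : (a, b) <> (0, 0) ->
  a * x.1 + b * x.2 = c -> a * y.1 + b * y.2 = c -> a * z.1 + b * z.2 = c ->
  det3 x y z = 0.
Proof.
move=> ab hx hy hz.
have e1 : a * (y.1 - x.1) = - (b * (y.2 - x.2)) by lra.
have e2 : a * (z.1 - x.1) = - (b * (z.2 - x.2)) by lra.
have ha : a * det3 x y z = 0.
  rewrite /det3 (_ : a * _ = (a * (y.1 - x.1)) * (z.2 - x.2) -
    (y.2 - x.2) * (a * (z.1 - x.1))); last by ring.
  by rewrite e1 e2; ring.
have hb : b * det3 x y z = 0.
  rewrite /det3 (_ : b * _ = (y.1 - x.1) * (b * (z.2 - x.2)) -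
    (b * (y.2 - x.2)) * (z.1 - x.1)); last by ring.
  have -> : b * (z.2 - x.2) = - (a * (z.1 - x.1)) by lra.
  have -> : b * (y.2 - x.2) = - (a * (y.1 - x.1)) by lra.
  by ring.
apply/eqP; apply: contra_notT ab => d0.
by move/eqP: ha; move/eqP: hb; rewrite !mulf_eq0 (negbTE d0) !orbF =>
  /eqP -> /eqP ->.
Qed.

Lemma triangle_det3 t v w : triangle t -> v != w ->
  exists2 z, z \in t & det3 z v w != 0.
Proof.
move=> [_ nc] vw; apply: contrapT => H; apply: nc.
apply: (collinear_det3 vw) => z zt; apply: contrapT => /eqP hz; apply: H.
by exists z; rewrite // (_ : det3 z v w = det3 v w z) // /det3; ring.
Qed.

Lemma noncollinear_triangle V : ~ collinear V ->
  exists t, triangle t /\ (t `<=` V)%fset.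
Proof.
move=> nc.
have [V0|/fset0Pn[a aV]] := eqVneq V fset0.
  by case: nc; exists 1, 0, 0; split; [case=> /eqP; rewrite oner_eq0|rewrite V0].
have [b bV ab] : exists2 b, b \in V & a != b.
  apply: contrapT => H; apply: nc; exists 1, 0, a.1; split.
    by case => /eqP; rewrite oner_eq0.
  move=> v vV; have [<-|av] := eqVneq a v; first by rewrite mul1r mul0r addr0.
  by case: H; exists v.
have [d dV d0] : exists2 d, d \in V & det3 a b d != 0.
  apply: contrapT => H; apply: nc.
  apply: (collinear_det3 ab) => z zV; apply: contrapT => /eqP hz.
  by apply: H; exists z.
exists [fset a; b; d]%fset; split.
  split; last first.
    move=> [a' [b' [c' [ab' H]]]]; move/eqP: d0; apply.
    by apply: (det3_affine_zero ab'); apply: H; rewrite !inE eqxx ?orbT.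
  rewrite [(_ `|` [fset d])%fset]fsetUC cardfsU1 cardfs2 ab !inE.
  case: eqP => [da|_]; first by move: d0; rewrite da /det3 !subrr !mulr0 subrr eqxx.
  by case: eqP => [da|_] //; move: d0; rewrite da /det3 mulrC subrr eqxx.
by apply/fsubsetP => z; rewrite !inE => /orP[/orP[]|] /eqP ->.
Qed.

(** The triangles over which the lower convex hull of the lifted points
[(v, h v)] has a facet with no other lifted point on it. *)
Definition lower_faces h V : {fset {fset (R * R)}} :=
  [fset t in fpowerset V |
    `[< triangle t /\ forall v, v \in V -> v \notin t -> interp h t v < h v >]]%fset.

Lemma lower_facesP h V t : t \in lower_faces h V <->
  [/\ (t `<=` V)%fset, triangle t &
    forall v, v \in V -> v \notin t -> interp h t v < h v].
Proof.
rewrite !inE /= fpowersetE; split => [/andP[tV /asboolP[tt H]]|[tV tt H]] //.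
by rewrite tV; apply/asboolP.
Qed.

(** A generic point near [p] is covered by [lower_cover_generic].  It is chosen so close
to [p] that each triangle missing [p] also misses it. *)
Lemma lower_cover h V p : ~ collinear V ->
  hull V p ->
  exists t, [/\ triangle t, (t `<=` V)%fset, hull t p &
    forall v, v \in V -> interp h t v <= h v].
Proof.
move=> /noncollinear_triangle[t0 [tt0 t0V]] Vp.
pose I := [seq (u, m) | u <- fpowerset V, m <- V].
have [e [y [e01 yt0 He]]] := generic_point p I tt0
  (fun um => affineN (affine_bary um.1 um.2)).
set x := p + e *: (y - p) in He.
have Vx : hull V x by apply: hull_seg => //; apply: hullS yt0.
have [|t [tt tV tx Ht]] := lower_cover_generic h tt0 t0V Vx.
  move=> t m tt tV mt; have mV := fsubsetP tV _ mt.
  have := (He (t, m)); rewrite allpairs_f ?fpowersetE //= => /(_ isT)[+ _].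
  rewrite oppr_eq0; apply.
  (* Otherwise [bary t ^~ m] would vanish on [t0], hence everywhere. *)
  apply: contrapT => H; have := bary_vertex tt mt mt.
  rewrite eqxx (affine_interpE m tt0 (affine_bary t m)) big_seq big1.
    by move/eqP; rewrite eq_sym oner_eq0.
  move=> z zt; apply/eqP; rewrite mulf_eq0; apply/orP; right.
  by apply: contrapT => /negP bz; apply: H; exists z; rewrite // oppr_eq0.
exists t; split => //; apply: contrapT => /(not_hull tt)[m mt bm].
have mV := fsubsetP tV _ mt.
have := (He (t, m)); rewrite allpairs_f ?fpowersetE //= => /(_ isT)[_].
rewrite !oppr_gt0 => /(_ bm); rewrite ltNge => /negP; apply.
exact: (hullP _ tt).1.
Qed.

Lemma lower_faces_triangulation h V : ~ collinear V ->
  (forall t v, triangle t -> (t `<=` V)%fset -> v \in V -> v \notin t ->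
     interp h t v != h v) ->
  (forall t v, triangle t -> (t `<=` V)%fset -> v \in V -> v \notin t ->
     hull t v -> h v <= interp h t v) ->
  triangulation V (lower_faces h V).
Proof.
move=> nc gen cvx.
have cov p : hull V p -> exists2 t, t \in lower_faces h V & hull t p.
  move=> /(lower_cover h nc)[t [tt tV tp Ht]]; exists t => //.
  apply/lower_facesP; split => // v vV vt.
  by rewrite lt_neqAle gen // Ht.
split.
- by move=> t /lower_facesP[tV [t3 tc] _].
- move=> v vV; have [t tT tv] := cov v (hull_vertex vV); exists t => //.
  move/lower_facesP: tT => [tV tt H]; apply: contrapT => /negP vt.
  by have := cvx t v tt tV vV vt tv; rewrite leNgt H.
- apply/seteqP; split => p; first exact: cov.
  by move=> [t /lower_facesP[tV _ _] tp]; apply: hullS tp.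
- move=> t u /lower_facesP[tV tt Ht] /lower_facesP[uV tu Hu].
  apply/seteqP; split => p; last first.
    by move=> tup; split; apply: hullS tup; rewrite ?fsubsetIl ?fsubsetIr.
  move=> [tp up]; apply: (hull_supp tu (fsubsetIr _ _) up) => v vu bv.
  rewrite inE vu andbT; apply: contrapT => /negP vt.
  have := @common_face h t u p tt tu _ _ tp up v vu bv.
  have le z t' : z \in V -> triangle t' ->
      (forall v, v \in V -> v \notin t' -> interp h t' v < h v) ->
      interp h t' z <= h z.
    move=> zV tt' Ht'; have [zt|zt] := boolP (z \in t').
      by rewrite interp_vertex.
    by rewrite ltW // Ht'.
  move=> E; have := Ht v (fsubsetP uV _ vu) vt; rewrite E ?ltxx //.
    by move=> z zu; apply: le => //; apply: (fsubsetP uV).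
  by move=> z zu; apply: le => //; apply: (fsubsetP tV).
Qed.

(** [v] is a vertex of some triangle, hence an extreme point of the face that this
triangle shares with [t]. *)
Lemma hull_vertex_mem V T t v : triangulation V T -> t \in T -> v \in V ->
  hull t v -> v \in t.
Proof.
move=> trT tT vV tv; have [H1 H2 H3 H4] := trT.
have [u uT vu] := H2 v vV.
have [tu _] := triangulation_triangle trT uT.
have H : hull (t `&` u)%fset v by rewrite -H4 //; split => //; apply: hull_vertex.
have := bary_subhull tu (fsubsetIr _ _) H vu.
rewrite bary_vertex // eqxx oner_eq0 => /(_ isT).
by rewrite inE => /andP[].
Qed.

Lemma exit_point t v x : triangle t -> hull t x -> ~ hull t v ->
  exists k (r : R), [/\ 0 <= r < 1, k \in t, bary t v k < 0,
    hull t (x + r *: (v - x)) & bary t (x + r *: (v - x)) k = 0].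
Proof.
move=> tt tx ntv.
have a0 := (hullP x tt).1 tx.
have [m mt bm] := not_hull tt ntv.
have [|k [r [kt dk r0 ak Hm]]] := @ratio_test _ t (bary t x)
  (fun m => bary t v m - bary t x m) a0.
  by exists m => //; have := a0 _ mt; lra.
have E z : bary t (x + r *: (v - x)) z = bary t x z + r * (bary t v z - bary t x z).
  exact: affine_seg (affine_bary t z).
have r1 : r < 1.
  rewrite ltNge; apply/negP => r1; have := Hm _ mt; have := a0 _ mt; nra.
exists k, r; split => //.
- by rewrite r0.
- rewrite ltNge; apply/negP => bk; have := a0 _ kt; nra.
- by apply/hullP => // z zt; rewrite E Hm.
- by rewrite E.
Qed.

(** * From convexity across edges to global convexity *)

(** Convexity of the interpolant of [s] across the edge [t minus k] of [t], which is
shared with the triangle having [l] in place of [k]. *)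
Definition edge_convex s T : Prop :=
  forall t k l, t \in T -> k \in t -> l != k -> (l |` (t `\ k))%fset \in T ->
    interp s t l <= s l.

Lemma bary_two_zero t k m q : triangle t -> k \in t -> m \in (t `\ k)%fset ->
  bary t q k = 0 -> bary t q m = 0 -> q \in t.
Proof.
move=> tt kt mt qk qm.
have /cardfs1P[w Hw] : #|` (t `\ k `\ m)%fset| == 1%N.
  have := cardfsD1 m (t `\ k)%fset.
  by rewrite mt (card_edge tt kt) add1n => -[<-].
have [b1 bx] := baryP tt q.
have wt : w \in t.
  have : w \in [fset w]%fset by rewrite inE.
  by rewrite -Hw !in_fsetD1 => /and3P[].
move: b1 bx; rewrite (big_fsetD1 k) //= qk add0r (big_fsetD1 m) //= qm add0r.
rewrite Hw big_seq_fset1 => w1.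
rewrite (big_fsetD1 k) //= qk scale0r add0r (big_fsetD1 m) //= qm scale0r add0r.
by rewrite Hw big_seq_fset1 w1 scale1r => ->.
Qed.

(** Walk along the segment from a generic point [p] of [t0] to [v].  Among the points
where the segment leaves a triangle [t] with [interp s t v] at least
[interp s t0 v], consider the last one.  It is not a vertex, so the triangle on
the other side of the edge has an interpolant which is at least as large at [v],
and it is left later: contradiction.  A fixed generic segment is needed for
the walk to end, because the order in which triangles hide one another
from [v] can have cycles. *)
Lemma edge_convex_below V T s : triangulation V T -> edge_convex s T ->
  forall t v, t \in T -> v \in V -> interp s t v <= s v.
Proof.
move=> trT loc t0 v t0T vV; rewrite leNgt; apply/negP => bad.
have TT := triangulation_triangle trT.
have [tt0 t0V] := TT _ t0T.
have good_nhull t : t \in T -> interp s t0 v <= interp s t v -> ~ hull t v.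
  move=> tT gt /(hull_vertex_mem trT tT vV) vt.
  by move: gt; rewrite (interp_vertex s (TT _ tT).1 vt) leNgt bad.
have t00 : t0 != fset0 by case: tt0 => t3 _; rewrite -cardfs_gt0 t3.
have [c [_ cpos _]] := face_center tt0 (fsubset_refl t0) t00.
(* The start [p] is inside [t0] and on no line joining [v] to another point of
   [V], so that the segment from [p] to [v] meets no vertex before [v]. *)
pose F (i : (R * R) + (R * R)) x :=
  match i with inl w => det3 x v w | inr m => bary t0 x m end.
have HF i : affine (F i).
  by case: i => [w|m]; [apply: affine_det3|apply: affine_bary].
have [e [y [e01 yt0 He]]] :=
  generic_point c (map inl (enum_fset V) ++ map inr (enum_fset t0)) tt0 HF.
set p := c + e *: (y - c) in He.
have gen w : w \in V -> v != w -> det3 p v w != 0.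
  move=> wV vw; have := He (inl w); rewrite mem_cat map_f //= => /(_ isT)[+ _].
  by apply; apply: triangle_det3.
have pt0 : hull t0 p.
  apply/hullP => // m mt; have := He (inr m).
  rewrite mem_cat [X in _ || X]map_f // orbT => /(_ isT)[_ /=].
  by move=> /(_ (cpos _ mt))/ltW.
pose pt (r : R) := p + r *: (v - p).
(* [crossing r]: at parameter [r] the segment leaves, through the edge opposite
   to [k], a triangle [t] whose interpolant is large enough at [v]. *)
pose crossing (r : R) := exists t k, [/\ t \in T, k \in t,
  interp s t0 v <= interp s t v, bary t v k < 0 &
  [/\ 0 <= r < 1, hull t (pt r) & bary t (pt r) k = 0]].
have exits t r : t \in T -> interp s t0 v <= interp s t v -> 0 <= r < 1 ->
    hull t (pt r) ->
    exists k r', [/\ r <= r', 0 <= r' < 1, k \in t, bary t v k < 0 &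
      hull t (pt r') /\ bary t (pt r') k = 0].
  move=> tT gt /andP[r0 r1] tr.
  have [k [r' [/andP[r'0 r'1] kt bk h1 h2]]] :=
    exit_point (TT _ tT).1 tr (good_nhull _ tT gt).
  have E : pt r + r' *: (v - pt r) = pt (r + r' * (1 - r)).
    rewrite /pt; apply: injective_projections.
      change (p.1 + r * (v.1 - p.1) + r' * (v.1 - (p.1 + r * (v.1 - p.1))) =
        p.1 + (r + r' * (1 - r)) * (v.1 - p.1)); ring.
    change (p.2 + r * (v.2 - p.2) + r' * (v.2 - (p.2 + r * (v.2 - p.2))) =
      p.2 + (r + r' * (1 - r)) * (v.2 - p.2)); ring.
  rewrite E in h1 h2; exists k, (r + r' * (1 - r)); split => //; last (apply/andP; split); nra.
(* The affine function [bary t ^~ k] vanishes only once on the segment, which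
   leaves finitely many candidates for a crossing. *)
pose cand (tk : {fset (R * R)} * (R * R)) : R :=
  bary tk.1 p tk.2 / (bary tk.1 p tk.2 - bary tk.1 v tk.2).
pose cands := [seq cand tk | tk <- [seq (t, k) | t <- T, k <- V]].
have cand_in r : crossing r -> r \in cands.
  move=> [t [k [tT kt _ bv [/andP[r0 r1] _ /eqP]]]].
  rewrite (affine_seg _ _ _ (affine_bary t k)) => /eqP br.
  have -> : r = cand (t, k).
    rewrite /cand /=; have d0 : bary t p k - bary t v k != 0.
      by apply/eqP => d0; move: br; rewrite -opprB d0 oppr0 mulr0 addr0; lra.
    by apply: (mulIf d0); rewrite divfK //; lra.
  by apply: map_f; apply: allpairs_f => //; apply: (fsubsetP (TT _ tT).2).
have pt0E : pt 0 = p by rewrite /pt scale0r addr0.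
have [|r [_ [t [k [tT kt gt bv [r01 tq bq]]]] rmax]] :=
    @seq_max _ id crossing cands.
  have [||k [r [_ r01 kt bk [h1 h2]]]] := exits t0 0 t0T (lexx _).
  - by rewrite lexx ltr01.
  - by rewrite pt0E.
  have cr : crossing r by exists t0, k; split.
  by exists r => //; apply: cand_in.
set q := pt r in tq bq.
have [tt tV] := TT _ tT.
(* Otherwise [q] would be a vertex on the line through [p] and [v]. *)
have bm m : m \in (t `\ k)%fset -> 0 < bary t q m.
  move=> mt; rewrite lt_def (hullP q tt).1 ?(fsubsetP (fsubD1set _ _) _ mt) // andbT.
  apply/eqP => bm0; have qt := bary_two_zero tt kt mt bq bm0.
  have vq : v != q.
    by apply/eqP => vq; apply: (good_nhull t) => //; rewrite vq; apply: hull_vertex.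
  have /eqP := gen q (fsubsetP tV _ qt) vq; apply; rewrite /q /pt /det3.
  change ((v.1 - p.1) * (p.2 + r * (v.2 - p.2) - p.2) -
    (v.2 - p.2) * (p.1 + r * (v.1 - p.1) - p.1) = 0); ring.
have [l [lV lt t'T blk]] := neighbour trT tT kt vV bv bq bm.
have [tt' t'V] := TT _ t'T.
set t' := (l |` _)%fset in t'T tt' t'V.
have lk : l != k by apply: contraNneq lt => ->.
have bvl : 0 < bary t' v l.
  by have := bary_swap v tt kt tt'; rewrite -/t' => E; rewrite E in bv; rewrite nmulr_llt0 // in bv.
have gt' : interp s t0 v <= interp s t' v.
  rewrite (interp_neighbour s v tt kt tt'); apply: (le_trans gt).
  by rewrite lerDl mulr_ge0 ?(ltW bvl) // subr_ge0; apply: (loc t k).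
have qe : hull (t `\ k)%fset q.
  apply: (hull_supp tt (fsubD1set _ _) tq) => z zt bz.
  by rewrite in_fsetD1 zt andbT; apply: contra_neq bz => ->.
have t'q : hull t' q by apply: hullS qe; apply: fsubsetU1.
have [k' [r' [rr' r'01 k't' bk' [h1 h2]]]] := exits t' r t'T gt' r01 t'q.
have cr' : crossing r' by exists t', k'; split.
(* By maximality [t'] would be left at [q] again, but [q] is interior to the
   edge shared with [t], and [v] is on the inner side of that edge. *)
have rE : r' = r by apply/eqP; rewrite eq_le rr' andbT; apply: rmax => //; apply: cand_in.
move: k't'; rewrite rE -/q in h2; rewrite in_fset1U => /predU1P[k'l|k't].
  by move: bk'; rewrite k'l ltNge (ltW bvl).
have := bm _ k't.
by rewrite (bary_face tt tt' (fsubD1set _ _) (fsubsetU1 _ _) qe k't) h2 ltxx.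
Qed.

Definition strict_edge_convex s T : Prop :=
  forall t k l, t \in T -> k \in t -> l != k -> (l |` (t `\ k))%fset \in T ->
    interp s t l < s l.

Lemma strict_edge_convexW s T : strict_edge_convex s T ->
  edge_convex s T.
Proof. by move=> H t k l tT kt lk t'T; apply/ltW/(H t k l). Qed.

(** One step towards [v] gains strictly, and what follows loses nothing. *)
Lemma strict_edge_convex_below V T s : triangulation V T ->
  strict_edge_convex s T ->
  forall t v, t \in T -> v \in V -> v \notin t -> interp s t v < s v.
Proof.
move=> trT loc t v tT vV vt.
have TT := triangulation_triangle trT; have [tt tV] := TT _ tT.
have nh : ~ hull t v by move/(hull_vertex_mem trT tT vV); apply/negP.
have [k kt bk] := not_hull tt nh.
have A0 : (t `\ k)%fset != fset0 by rewrite -cardfs_gt0 card_edge.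
have [q [_ q1 q2]] := face_center tt (fsubD1set t k) A0.
have qk : bary t q k = 0 by rewrite q2 // in_fsetD1 eqxx.
have [l [lV lt t'T blk]] := neighbour trT tT kt vV bk qk q1.
have [tt' _] := TT _ t'T.
have lk : l != k by apply: contraNneq lt => ->.
have bvl : 0 < bary (l |` (t `\ k))%fset v l.
  by move: (bk); rewrite (bary_swap v tt kt tt') nmulr_llt0.
have wl := strict_edge_convexW loc.
apply: lt_le_trans (edge_convex_below trT wl t'T vV).
rewrite (interp_neighbour s v tt kt tt') ltrDl mulr_gt0 // subr_gt0.
exact: (loc t k).
Qed.

(** Over the barycenter of a triangle [t] of [T'] lies a triangle [u] of [T].  Both
interpolants stay below [s] on [V], so by [common_face] that of [u] equals [s]
at the vertices of [t]; by strictness these are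
vertices of [u].  Conversely a triangle of [T] meets some triangle of [T'] at
its barycenter, and the latter already belongs to [T]. *)
Lemma edge_convex_unique V T T' s : triangulation V T ->
  strict_edge_convex s T -> triangulation V T' -> edge_convex s T' ->
  T' = T.
Proof.
move=> trT sT trT' lT'.
have below := strict_edge_convex_below trT sT.
have TT := triangulation_triangle trT; have TT' := triangulation_triangle trT'.
have wT := strict_edge_convexW sT.
have cov t U W : triangulation V U -> triangulation V W -> t \in U ->
    exists q u, [/\ u \in W, hull u q, hull t q & forall v, v \in t -> 0 < bary t q v].
  move=> trU trW tU; have [tt tV] := triangulation_triangle trU tU.
  have t0 : t != fset0 by case: tt => t3 _; rewrite -cardfs_gt0 t3.
  have [q [tq qpos _]] := face_center tt (fsubset_refl t) t0.
  have [_ _ H3 _] := trW.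
  have : hull V q by apply: hullS tq.
  by rewrite H3 => -[u uW uq]; exists q, u.
have sub t : t \in T' -> t \in T.
  move=> tT'; have [q [u [uT uq tq qpos]]] := cov t _ _ trT' trT tT'.
  have [tt tV] := TT' _ tT'; have [tu uV] := TT _ uT.
  have tu' : (t `<=` u)%fset.
    apply/fsubsetP => v vt; apply: contrapT => /negP vu.
    have vV := fsubsetP tV _ vt.
    have := @common_face s u t q tu tt _ _ uq tq v vt; rewrite gt_eqF ?qpos //.
    move=> E; have := below u v uT vV vu; rewrite E ?ltxx //.
      by move=> z zt; apply: (edge_convex_below trT wT) => //; apply: (fsubsetP tV).
    by move=> z zu; apply: (edge_convex_below trT' lT') => //; apply: (fsubsetP uV).
  suff -> : t = u by [].
  by apply/eqP; rewrite eqEfcard tu' (proj1 tt) (proj1 tu).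
apply/fsetP => t; apply/idP/idP; first exact: sub.
move=> tT; have [q [u [uT' uq tq qpos]]] := cov t _ _ trT trT' tT.
have [tt tV] := TT _ tT; have [tu uV] := TT' _ uT'.
have uT := sub _ uT'.
have [_ _ _ H4] := trT.
have tuq : hull (t `&` u)%fset q by rewrite -H4.
suff -> : t = u by [].
apply/eqP; rewrite eqEfcard (proj1 tt) (proj1 tu) leqnn andbT.
apply/fsubsetP => v vt.
have := bary_subhull tt (fsubsetIl _ _) tuq vt; rewrite gt_eqF ?qpos // => /(_ isT).
by rewrite inE => /andP[].
Qed.

(** * The hinge formula *)

(** By Lagrange's identity, the squares of the scalar and of the cross product add
up to the product of the squared lengths. *)
Lemma cot_angle x y z : det3 y x z != 0 ->
  cot (angle x y z) = dot (x - y) (z - y) / `|det3 y x z|.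
Proof.
move=> d0; rewrite /cot /angle /enorm.
set d := dot (x - y) (z - y).
set a := dot (x - y) (x - y); set b := dot (z - y) (z - y).
have abE : a * b = d ^+ 2 + det3 y x z ^+ 2.
  by rewrite /a /b /d /dot /det3 /=; ring.
have a0 : 0 <= a by rewrite /a /dot addr_ge0 // -expr2 sqr_ge0.
have b0 : 0 <= b by rewrite /b /dot addr_ge0 // -expr2 sqr_ge0.
have D0 : 0 < det3 y x z ^+ 2 by rewrite exprn_even_gt0.
have ab0 : 0 < a * b by rewrite abE ltr_wpDl // sqr_ge0.
rewrite -sqrtrM //; set N := Num.sqrt (a * b).
have N0 : 0 < N by rewrite sqrtr_gt0.
have N2 : N ^+ 2 = d ^+ 2 + det3 y x z ^+ 2 by rewrite sqr_sqrtr // ltW.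
have dN : `|d / N| <= 1.
  rewrite normrM normfV (gtr0_norm N0) ler_pdivrMr // mul1r.
  by rewrite -(ler_pXn2r (n := 2)) ?nnegrE ?normr_ge0 ?(ltW N0) // real_normK
    ?num_real // N2 lerDl ltW.
have dI : -1 <= d / N <= 1 by rewrite -ler_norml.
rewrite acosK; last by rewrite in_itv.
rewrite sin_acos //.
have -> : 1 - (d / N) ^+ 2 = (det3 y x z / N) ^+ 2.
  by rewrite !exprMn !exprVn N2; field; rewrite -N2 expf_neq0 // gt_eqF.
rewrite sqrtr_sqr normrM normfV (gtr0_norm N0).
by field; rewrite normr_eq0 d0 gt_eqF.
Qed.

(** The constant is twice the area of [ijl].  The identity compares coefficients of
[s]; the hypothesis that [k] and [l] are on opposite sides decides the signs of
the two areas. *)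
Lemma hinge_interp s (i j k l : R * R) :
  triangle [fset i; j; k]%fset -> bary [fset i; j; k]%fset l k < 0 ->
  exists2 c : R, 0 < c &
    s l - interp s [fset i; j; k]%fset l = c * hinge s i j k l.
Proof.
move=> [t3 nc].
have [ij ik jk] : [/\ i != j, i != k & j != k].
  move: t3; rewrite [(_ `|` [fset k])%fset]fsetUC cardfsU1 cardfs2 !inE negb_or.
  by rewrite ![k == _]eq_sym; case: (i != j); case: (i != k); case: (j != k).
have d1 := det3_neq0 ij nc.
have [bi bj bk] := bary3 l ij ik jk d1.
rewrite /interp sum3 // bi bj bk => neg.
have d2 : det3 i j l != 0 by apply: contraTneq neg => ->; rewrite mul0r ltxx.
have sw x y z : det3 y x z = - det3 x y z by rewrite /det3; ring.
have nsw x y z : `|det3 y x z| = `|det3 x y z| by rewrite sw normrN.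
have n0 x y z : (det3 y x z != 0) = (det3 x y z != 0) by rewrite sw oppr_eq0.
exists `|det3 i j l|; first by rewrite normr_gt0.
rewrite /hinge !cot_angle //; try by rewrite n0.
rewrite (nsw i j k) (nsw i j l) /tri_area -/(det3 i j k) -/(det3 i j l).
have E : enorm (i - j) ^+ 2 = dot (i - j) (i - j).
  by rewrite /enorm sqr_sqrtr // /dot addr_ge0 // -expr2 sqr_ge0.
rewrite E.
have e0 : dot (i - j) (i - j) != 0.
  apply: contraNneq ij => e0; apply/eqP; apply: injective_projections;
  apply/eqP; rewrite -subr_eq0; move: e0; rewrite /dot /= => /eqP;
  by rewrite -!expr2 paddr_eq0 ?sqr_ge0 // !sqrf_eq0 => /andP[].
have [p1|p1] := ltP 0 (det3 i j k).
  have p2 : det3 i j l < 0 by rewrite pmulr_llt0 ?invr_gt0 in neg.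
  rewrite (gtr0_norm p1) (ltr0_norm p2).
  move: d1 d2 e0; rewrite /det3 /dot /= => d1 d2 e0; field.
  by rewrite d1 d2 e0.
have {}p1 : det3 i j k < 0 by rewrite lt_neqAle d1.
have p2 : 0 < det3 i j l by rewrite nmulr_llt0 ?invr_lt0 in neg.
rewrite (ltr0_norm p1) (gtr0_norm p2).
move: d1 d2 e0; rewrite /det3 /dot /= => d1 d2 e0; field.
by rewrite d1 d2 e0.
Qed.

(** * Convex heights and their perturbation *)

Lemma convex_seg (Om : set (R * R)) s x y (r : R) :
  convex_set Om -> convex_function Om s -> Om x -> Om y -> 0 <= r <= 1 ->
  Om (x + r *: (y - x)) /\ s (x + r *: (y - x)) <= s x + r * (s y - s x).
Proof.
move=> cO cs Ox Oy /andP[r0 r1].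
have E : x + r *: (y - x) = conv (Itv01 r0 r1 : {i01 R})
    (y : convex_lmodType (R * R)%type) (x : convex_lmodType (R * R)%type).
  by rewrite /conv /= scalerBr scalerBl scale1r addrCA.
rewrite -> E; split.
  by apply/set_mem; apply: cO; rewrite inE.
have := cs (Itv01 r0 r1) y x (mem_set Oy) (mem_set Ox).
have -> : s x + r * (s y - s x) = r * s y + (1 - r) * s x by ring.
exact.
Qed.

(** Jensen's inequality for three points, from two applications of convexity on
segments. *)
Lemma convex_interp (Om : set (R * R)) s t v :
  convex_set Om -> convex_function Om s -> triangle t ->
  (forall a, a \in t -> Om a) -> hull t v -> s v <= interp s t v.
Proof.
move=> cO cs tt; move: (tt) => [/card3P[a [b [c [ab ac bc tE]]]] _] tO tv.
have [b1 bx] := baryP tt v; have b0 := (hullP v tt).1 tv.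
move: b1 bx b0; rewrite /interp tE !sum3 // -tE.
set wa := bary t v a; set wb := bary t v b; set wc := bary t v c => w1 vE b0.
have [at_ bt ct] : [/\ a \in t, b \in t & c \in t] by rewrite tE !inE !eqxx ?orbT.
have wa0 : 0 <= wa by apply: b0.
have wb0 : 0 <= wb by apply: b0.
have wc0 : 0 <= wc by apply: b0.
(* [v] is on the segment from [a] to a point [y] of the segment [b c], unless
   [v = a]. *)
have [d0|d0] := eqVneq (wb + wc) 0.
  have e1 : wb = 0 by lra.
  have e2 : wc = 0 by lra.
  have e3 : wa = 1 by lra.
  by rewrite vE e1 e2 e3 !scale0r !mul0r !addr0 scale1r mul1r.
have dp : 0 < wb + wc by rewrite lt_def d0 addr_ge0.
pose r := wc / (wb + wc).
have r01 : 0 <= r <= 1.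
  by rewrite /r divr_ge0 ?addr_ge0 //= ler_pdivrMr // mul1r lerDr.
have [Oy sy] := convex_seg cO cs (tO _ bt) (tO _ ct) r01.
set y := b + r *: (c - b) in Oy sy.
have d01 : 0 <= wb + wc <= 1 by rewrite ltW //=; lra.
have [_ sv] := convex_seg cO cs (tO _ at_) Oy d01.
have rD : r * (wb + wc) = wc by rewrite /r divfK.
clearbody r; have [D DE] : exists D, wb + wc = D by exists (wb + wc).
rewrite DE in dp sv rD.
have aE : wa = 1 - D by rewrite -DE -w1; ring.
have bE : wb = D - r * D by rewrite rD -DE; ring.
have vE' : v = a + D *: (y - a).
  rewrite {}vE /y aE bE -rD; apply: injective_projections.
    change ((1 - D) * a.1 + (D - r * D) * b.1 + (r * D) * c.1 =
      a.1 + D * (b.1 + r * (c.1 - b.1) - a.1)); ring.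
  change ((1 - D) * a.2 + (D - r * D) * b.2 + (r * D) * c.2 =
    a.2 + D * (b.2 + r * (c.2 - b.2) - a.2)); ring.
rewrite vE'; apply: (le_trans sv).
have : D * s y <= D * (s b + r * (s c - s b)) by rewrite ler_pM2l.
rewrite aE bE -rD; lra.
Qed.

Lemma edge_endpoints t k : triangle t -> k \in t ->
  exists i j, (t `\ k)%fset = [fset i; j]%fset /\ t = [fset i; j; k]%fset.
Proof.
move=> tt kt.
have c2 := card_edge tt kt.
have /fset0Pn[i ti] : (t `\ k)%fset != fset0 by rewrite -cardfs_gt0 c2.
have := cardfsD1 i (t `\ k)%fset; rewrite ti c2 add1n => -[] /esym/eqP/cardfs1P[j hj].
exists i, j; have E : (t `\ k)%fset = [fset i; j]%fset by rewrite -hj fsetD1K.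
by split => //; rewrite -E fsetUC fsetD1K.
Qed.

Lemma edge_set (i j k : R * R) : triangle [fset i; j; k]%fset ->
  ([fset i; j; k] `\ k)%fset = [fset i; j]%fset.
Proof.
move=> [t3 _]; rewrite fsetUC fsetU1K //.
by move: t3; rewrite fsetUC cardfsU1 cardfs2; case: (k \notin _) => //; case: (i != j).
Qed.

Lemma interior_edge_hinge V T s (i j k l : R * R) : triangulation V T ->
  interior_edge T i j k l ->
  exists2 c : R, 0 < c &
    s l - interp s [fset i; j; k]%fset l = c * hinge s i j k l.
Proof.
move=> trT [kT lT kl].
have [tt _] := triangulation_triangle trT kT.
apply: hinge_interp => //; apply: (edge_opposite trT kT).
- by rewrite !inE eqxx orbT.
- by rewrite eq_sym.
- by rewrite edge_set // fsetUC.
Qed.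

Lemma interior_edge_flap V T t k l : triangulation V T -> t \in T -> k \in t ->
  l != k -> (l |` (t `\ k))%fset \in T ->
  exists i j, t = [fset i; j; k]%fset /\ interior_edge T i j k l.
Proof.
move=> trT tT kt lk t'T.
have [i [j [E tE]]] := edge_endpoints (triangulation_triangle trT tT).1 kt.
exists i, j; split => //; split; rewrite -?tE //; last by rewrite eq_sym.
by rewrite fsetUC -E.
Qed.

Lemma adapted_edge_convex V T s : triangulation V T ->
  adapted s T <-> edge_convex s T.
Proof.
move=> trT; split.
  move=> ad t k l tT kt lk t'T.
  have [i [j [tE ed]]] := interior_edge_flap trT tT kt lk t'T.
  have [c c0 E] := interior_edge_hinge s trT ed.
  by rewrite -subr_ge0 tE E mulr_ge0 ?(ltW c0) //; apply: ad.
move=> loc i j k l ed; have [c c0 E] := interior_edge_hinge s trT ed.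
move: (ed) => [kT lT kl]; have [tt _] := triangulation_triangle trT kT.
rewrite -(pmulr_rge0 _ c0) -E subr_ge0; apply: (loc _ k) => //.
- by rewrite !inE eqxx orbT.
- by rewrite eq_sym.
- by rewrite edge_set // fsetUC.
Qed.

Lemma adapted_strict_edge_convex V T s : triangulation V T -> adapted s T ->
  ~ (exists i j k l : R * R, interior_edge T i j k l /\ hinge s i j k l = 0) ->
  strict_edge_convex s T.
Proof.
move=> trT ad n0 t k l tT kt lk t'T.
have [i [j [tE ed]]] := interior_edge_flap trT tT kt lk t'T.
have [c c0 E] := interior_edge_hinge s trT ed.
rewrite -subr_gt0 tE E mulr_gt0 // lt_def ad // andbT.
by apply/eqP => h0; apply: n0; exists i, j, k, l.
Qed.

(** The gap is the variance of the vertices under the barycentric weights of [v]. *)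
Lemma sqnorm_strict t v : triangle t -> hull t v -> v \notin t ->
  dot v v < interp (fun z => dot z z) t v.
Proof.
move=> tt tv vt; have b0 := (hullP v tt).1 tv.
pose L z := dot (z - v) (z - v) - dot z z.
have aL : affine L.
  exists (-2 * v.1), (-2 * v.2), (dot v v) => z.
  by rewrite /L /dot /=; ring.
have := affine_interpE v tt aL.
have -> : L v = - dot v v by rewrite /L /dot /=; ring.
rewrite /L; under eq_bigr do rewrite mulrBr.
rewrite sumrB => E.
rewrite -subr_gt0.
have -> : interp (fun z => dot z z) t v - dot v v =
  \sum_(z <- t) bary t v z * dot (z - v) (z - v).
  by rewrite E /interp addrC subrK.
have d0 z : 0 <= dot (z - v) (z - v) by rewrite /dot addr_ge0 // -expr2 sqr_ge0.
have ge0 z : z \in t -> 0 <= bary t v z * dot (z - v) (z - v).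
  by move=> zt; rewrite mulr_ge0 // b0.
rewrite big_seq lt_def sumr_ge0 // andbT psumr_eq0 //; apply/negP => /allP H.
have : \sum_(z <- t) bary t v z = 0.
  rewrite big_seq big1 // => z zt; have := H z zt; rewrite zt mulf_eq0 /=.
  case/orP => [/eqP //|]; rewrite /dot -!expr2 paddr_eq0 ?sqr_ge0 // !sqrf_eq0 /=.
  rewrite !subr_eq0 => /andP[/eqP z1 /eqP z2].
  have zv : z = v by apply: injective_projections.
  by rewrite zv in zt; rewrite zt in vt.
by rewrite (sum_bary v tt) => /eqP; rewrite oner_eq0.
Qed.

(** [gap (t, v)], as a polynomial in [e], is the height of [t] over [v] minus the
height of [v], for the perturbed heights [h e].  It is never the zero polynomial:
the power of [e] reserved for [v] occurs with coefficient [-1].  Over points of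
[t] other than its vertices it is positive for small [e], its constant term
being nonnegative by convexity and its linear term positive by strict convexity
of the squared norm. *)
Lemma edge_convex_exists V s : ~ collinear V ->
  (forall t v, triangle t -> (t `<=` V)%fset -> v \in V -> hull t v ->
     s v <= interp s t v) ->
  exists T, triangulation V T /\ edge_convex s T.
Proof.
move=> nc cvx.
pose Q v : {poly R} := (dot v v)%:P + 'X^((index v V).+1).
pose h (e : R) v := s v + e * (Q v).[e].
pose G (tv : {fset (R * R)} * (R * R)) : {poly R} :=
  \sum_(u <- tv.1) bary tv.1 tv.2 u *: Q u - Q tv.2.
pose gap tv : {poly R} := (interp s tv.1 tv.2 - s tv.2)%:P + 'X * G tv.
pose I := [seq (t, v) | t <- fpowerset V, v <- V].
have [e [e0 e1 He]] := small_param ([seq gap i | i <- I] ++ [seq G i | i <- I]).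
have II t v : (t `<=` V)%fset -> v \in V -> (t, v) \in I.
  by move=> tV vV; apply: allpairs_f; rewrite ?fpowersetE.
have Hgap t v : (t `<=` V)%fset -> v \in V ->
  (gap (t, v) != 0 -> (gap (t, v)).[e] != 0) /\
  (0 < (gap (t, v)).[0] -> 0 < (gap (t, v)).[e]).
  by move=> tV vV; apply: He; rewrite mem_cat map_f // II.
have HG t v : (t `<=` V)%fset -> v \in V -> 0 < (G (t, v)).[0] -> 0 < (G (t, v)).[e].
  by move=> tV vV; apply: (He _ _).2; rewrite mem_cat orbC map_f // II.
have gapE t v : (gap (t, v)).[e] = interp (h e) t v - h e v.
  rewrite /gap hornerD hornerC hornerM hornerX /G hornerD hornerN horner_sum.
  under eq_bigr do rewrite hornerZ.
  rewrite /interp /h.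
  under [in RHS]eq_bigr do rewrite mulrDr mulrCA.
  rewrite big_split /= -mulr_sumr.
  by ring.
have gap_neq0 t v : (t `<=` V)%fset -> v \in V -> v \notin t -> gap (t, v) != 0.
  move=> tV vV vt; apply/eqP => /(congr1 (fun p : {poly R} => p`_(index v V).+2)).
  (* Only [v] contributes to degree [(index v V).+2]. *)
  rewrite coef0 coefD coefC coefXM /= add0r /G coefB coef_sum big_seq big1 => [|u ut].
    rewrite sub0r coefD coefC coefXn eqxx add0r => /eqP.
    by rewrite oppr_eq0 oner_eq0.
  rewrite coefZ coefD coefC coefXn add0r eqSS.
  case: eqP => [E|_]; last by rewrite mulr0.
  have uv : v = u by apply: (index_inj v vV _ E); apply: (fsubsetP tV).
  by rewrite uv ut in vt.
exists (lower_faces (h e) V).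
have trT : triangulation V (lower_faces (h e) V).
  apply: lower_faces_triangulation => // [t v tt tV vV vt|t v tt tV vV vt tv].
    by rewrite -subr_eq0 -gapE; apply: (Hgap t v tV vV).1; apply: gap_neq0.
  rewrite -subr_ge0 -gapE /gap hornerD hornerC hornerM hornerX.
  rewrite addr_ge0 ?subr_ge0 ?cvx // mulr_ge0 ?(ltW e0) // ltW // HG //.
  rewrite /G hornerD hornerN horner_sum.
  have Q0 (u : R * R) : (Q u).[0] = dot u u by rewrite /Q !hornerE expr0n /= addr0.
  under eq_bigr do rewrite hornerZ Q0.
  by rewrite Q0 subr_gt0; apply: sqnorm_strict.
split => // t k l tT kt lk t'T; rewrite leNgt; apply/negP => bad.
have [tV tt H] := (lower_facesP _ _ _).1 tT.
have [t'V tt' _] := (lower_facesP _ _ _).1 t'T.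
have lV : l \in V by apply: (fsubsetP t'V); rewrite in_fset1U eqxx.
have lt : l \notin t.
  have : l \notin (t `\ k)%fset.
    by case: tt' => + _; rewrite cardfsU1 card_edge //; case: (l \notin _).
  by rewrite in_fsetD1 lk.
(* A positive gap at [e = 0] would have stayed positive. *)
have := H l lV lt; rewrite -subr_lt0 -gapE ltNge => /negP; apply; apply/ltW.
apply: (Hgap t l tV lV).2.
by rewrite /gap hornerD hornerC hornerM hornerX mul0r addr0 subr_gt0.
Qed.

End Triangulations.

Theorem theorem4p1 (R : realType) (Om : set (R * R))
    (hOm : C2_convex_domain Om)
    (Q : R * R -> 'M[R]_2) (hQ : in_Mdiv Om Q)
    (s : R * R -> R) (hs : parameterized_by Om Q s)
    (V : {fset (R * R)}) (hV : forall v, v \in V -> Om v)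
    (hcol : ~ collinear V) :
  (exists T : {fset {fset (R * R)}}, triangulation V T /\ adapted s T) /\
  (forall T : {fset {fset (R * R)}},
     triangulation V T -> adapted s T ->
     ~ (exists i j k l : R * R,
          interior_edge T i j k l /\ hinge s i j k l = 0) ->
     forall T' : {fset {fset (R * R)}},
       triangulation V T' -> adapted s T' -> T' = T).
Proof.
have [_ _ cO _] := hOm; have [cs _] := hs; split.
  have [|T [trT lT]] := @edge_convex_exists R V s hcol.
    move=> t v tt tV vV tv; apply: (convex_interp cO cs tt) => // a at_.
    by apply: hV; apply: (fsubsetP tV).
  by exists T; split => //; apply/(adapted_edge_convex _ trT).
move=> T trT aT n0 T' trT' aT'.
apply: (edge_convex_unique trT _ trT').
  exact: adapted_strict_edge_convex trT aT n0.
exact/(adapted_edge_convex _ trT').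
Qed.
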